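(* Let $T$ be a complete countable first-order theory with monster model $\mathfrak{C}$, and let $\alpha,\beta$ be countable ordinals. Suppose that $(\alpha,\beta,G,H,\langle V_n,U_n\mid n<\omega\rangle,\cdot,X,* )$ is a bounded $F_\sigma$ action and that $Y\subseteq\mathfrak{C}^\alpha$ is a pseudo $G_\delta$ set contained in $X$ which is $E_G^X$-invariant. If for some shifty $a\in Y$ the relation $E_G^X\upharpoonright G*a$ is not strongly closed (i.e. there is no $n<\omega$ with $E_G^X\cap(G*a)^2=U_n\cap(G*a)^2$), then $E_G^X\upharpoonright Y$ is non-smooth.
   Context: $\mathfrak{C}$ is a monster model of $T$: $\kappa$-saturated and $\kappa$-homogeneous for a big cardinal $\kappa$. ''Small'' means of cardinality $<\kappa$; all parameter sets and models ($M\prec\mathfrak{C}$) are small. A subset of $\mathfrak{C}^\alpha$ is pseudo closed if it is type definable over some small set, pseudo open if its complement is pseudo closed, and pseudo $G_\delta$ (pseudo $F_\sigma$) if it is a countable intersection of pseudo open (countable union of pseudo closed) sets. $\emptyset$-invariant means invariant under $\operatorname{Aut}(\mathfrak{C})$. An $F_\sigma$ action is a tuple $(\alpha,\beta,G,H,\langle V_n,U_n\mid n<\omega\rangle,\cdot,X,* )$ where: $H\subseteq\mathfrak{C}^\beta$ and $(H,\cdot)$ is an $\emptyset$-type definable group (both $H$ and the multiplication are $\emptyset$-type definable); $G\leq H$ is an $\emptyset$-invariant pseudo $F_\sigma$ subgroup, $G=\bigcup_{n<\omega}V_n$ with $V_n$ $\emptyset$-type definable, $e\in V_n$, $V_n=V_n^{-1}$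 and $V_n\cdot V_n\subseteq V_{n+1}$; $X\subseteq\mathfrak{C}^\alpha$ is $\emptyset$-type definable and $*$ is an $\emptyset$-type definable group action of $H$ on $X$; and $U_n=\{(a,b)\in X\times X\mid\exists g\in V_n\,(g*a=b)\}$. $E_G^X=\bigcup_nU_n$ is the orbit equivalence relation of the action of $G$ on $X$. The action is bounded if $|X/E_G^X|<\kappa$. $a\in X$ is shifty if one of the following holds: (1) (right shifty) for every $k<\omega$ there is $n<\omega$ such that for all $g_1,g_2\in H$, if $(g_1*a,g_2*a)\in U_k$ then $((g_1\cdot g_2^{-1})*a,a)\in U_n$; or (2) (left shifty) for every $k<\omega$ there is $n<\omega$ such that for all $g_1,g_2\in H$, if $(g_1*a,g_2*a)\in U_k$ then $((g_1^{-1}\cdot g_2)*a,a)\in U_n$, and if $((g_1^{-1}\cdot g_2)*a,a)\in U_k$ then $(g_1*a,g_2*a)\in U_n$. For a model $M$ and $Z\subseteq\mathfrak{C}^\alpha$, $Z_M=\{\operatorname{tp}(a/M)\mid a\in Z\}\subseteq S_\alpha(M)$ with the topology induced from the Stone space. For an $\emptyset$-invariant bounded equivalence relation $E$ on $X$ and $p,q\in X_M$, $p\mathrel{E^M}q$ iff there are $a\models p$, $b\models q$ with $a\mathrel{E}b$ (equivalently, for all such $a,b$). For countable $M$, $Y_M$ is Polish and the Borel cardinality of $E^M\upharpoonright Y_M$ does not depend on the choice of countable $M$. ''$E\upharpoonright Y$ is smooth'' means that for some (equivalently every) countable model $M$ there is a Borel map $f:Y_M\to2^\omega$ with $p\mathrel{E^M}q\iff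 f(p)=f(q)$; non-smooth is the negation. *)

(* Defs.v *)
From HB Require Import structures.
From mathcomp Require Import all_boot.
From mathcomp Require Import boolp classical_sets functions cardinality wochoice.
From mathcomp Require Import topology cantor measurable_structure.

Set Implicit Arguments.
Unset Strict Implicit.
Unset Printing Implicit Defensive.

Local Open Scope classical_set_scope.
Local Open Scope card_scope.

Record signature := Signature {
  fsym : Type; far : fsym -> nat;
  rsym : Type; rar : rsym -> nat }.

Definition countable_signature (L : signature) : Prop :=
  countable [set: fsym L] /\ countable [set: rsym L].

Inductive term (L : signature) (V : Type) : Type :=
| Var of V
| App (f : fsym L) of ('I_(far f) -> term L V).

(* Formulas with free variables in [V]; a quantifier binds the variable [None]
   of its body. *)
Inductive formula (L : signature) (V : Type) : Type :=
| Bot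
| Equ of term L V & term L V
| Rel (r : rsym L) of ('I_(rar r) -> term L V)
| Imp of formula L V & formula L V
| All of formula L (option V).

Arguments Bot {L V}.

Definition Neg (L : signature) (V : Type) (phi : formula L V) := Imp phi Bot.

Record structure (L : signature) := Structure {
  carrier :> Type;
  carrier_inh : inhabited carrier;
  fint : forall f : fsym L, ('I_(far f) -> carrier) -> carrier;
  rint : forall r : rsym L, ('I_(rar r) -> carrier) -> Prop }.

Fixpoint teval (L : signature) (M : structure L) (V : Type) (v : V -> M)
    (t : term L V) : M :=
  match t with
  | Var x => v x
  | App f ts => fint (fun i => teval v (ts i))
  end.

Definition vcons (M V : Type) (x : M) (v : V -> M) : option V -> M :=
  fun o => if o is Some y then v y else x.

Fixpoint sat (L : signature) (M : structure L) (V : Type) (phi : formula L V) :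
    (V -> M) -> Prop :=
  match phi with
  | Bot => fun _ => False
  | Equ t1 t2 => fun v => teval v t1 = teval v t2
  | Rel r ts => fun v => rint (fun i => teval v (ts i))
  | Imp phi1 phi2 => fun v => sat phi1 v -> sat phi2 v
  | All phi1 => fun v => forall x : M, sat phi1 (vcons x v)
  end.

Definition theory (L : signature) := set (formula L void).

Definition no_var (M : Type) : void -> M := fun x => match x with end.

Definition models (L : signature) (M : structure L) (T : theory L) : Prop :=
  forall phi, T phi -> sat phi (@no_var M).

Definition entails (L : signature) (T : theory L) (phi : formula L void) : Prop :=
  forall M : structure L, models M T -> sat phi (@no_var M).

Definition complete_theory (L : signature) (T : theory L) : Prop :=
  (exists M : structure L, models M T) /\
  forall phi, entails T phi \/ entails T (Neg phi).

Definition is_substructure (L : signature) (C : structure L) (M : set C) : Prop :=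
  M !=set0 /\
  forall (f : fsym L) (ts : 'I_(far f) -> C),
    (forall i, M (ts i)) -> M (fint ts).

Lemma substructure_inh (L : signature) (C : structure L) (M : set C) :
  is_substructure M -> inhabited {x : C | M x}.
Proof. by case=> -[x Mx] _; exact: (inhabits (exist _ x Mx)). Qed.

Definition substructure (L : signature) (C : structure L) (M : set C)
    (hM : is_substructure M) : structure L :=
  @Structure L {x : C | M x} (substructure_inh hM)
    (fun f ts => exist _ (fint (fun i => sval (ts i)))
                   (hM.2 f (fun i => sval (ts i)) (fun i => svalP (ts i))))
    (fun r ts => rint (fun i => sval (ts i))).

Definition elementary_submodel (L : signature) (C : structure L) (M : set C) : Prop :=
  exists hM : is_substructure M,
    forall (n : nat) (phi : formula L 'I_n) (v : 'I_n -> substructure hM),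
      sat phi v <-> sat phi (fun i => sval (v i) : C).

(* Formulas with free variables in [I] and parameters from [A]. *)
Definition pformula (L : signature) (C : structure L) (I : Type) (A : set C) :=
  formula L (I + A)%type.

Definition psat (L : signature) (C : structure L) (I : Type) (A : set C)
    (phi : pformula I A) (a : I -> C) : Prop :=
  sat phi (fun x => match x with inl i => a i | inr c => set_val c end).

Definition finitely_satisfiable (L : signature) (C : structure L) (I : Type)
    (A : set C) (p : set (pformula I A)) : Prop :=
  forall D, D `<=` p -> finite_set D ->
    exists a : I -> C, forall phi, D phi -> psat phi a.

Definition realizes (L : signature) (C : structure L) (I : Type)
    (A : set C) (a : I -> C) (p : set (pformula I A)) : Prop :=
  forall phi, p phi -> psat phi a.

(* A cardinal [kappa] is given by a type [K] of that cardinality;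
   [small K A] means that the cardinality of [A] is less than [kappa]. *)
Definition small (K U : Type) (A : set U) : Prop :=
  (A #<= [set: K]) /\ ~ ([set: K] #<= A).

Definition automorphism (L : signature) (C : structure L) (s : C -> C) : Prop :=
  [/\ bijective s,
      forall (f : fsym L) (ts : 'I_(far f) -> C),
        s (fint ts) = fint (fun i => s (ts i))
    & forall (r : rsym L) (ts : 'I_(rar r) -> C),
        rint ts <-> rint (fun i => s (ts i))].

Definition saturated (L : signature) (K : Type) (C : structure L) : Prop :=
  forall (A : set C) (p : set (pformula unit A)),
    small K A -> finitely_satisfiable p -> exists a, realizes a p.

Definition elementary_map (L : signature) (C : structure L) (A : set C)
    (f : A -> C) : Prop :=
  forall (n : nat) (phi : formula L 'I_n) (v : 'I_n -> A),
    sat phi (fun i => set_val (v i)) <-> sat phi (fun i => f (v i)).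

(* Homogeneity is meant in the strong sense usual for monster models: small
   partial elementary maps extend to automorphisms. *)
Definition homogeneous (L : signature) (K : Type) (C : structure L) : Prop :=
  forall (A : set C) (f : A -> C), small K A -> elementary_map f ->
    exists2 s : C -> C, automorphism s & forall x : A, s (set_val x) = f x.

(* The cardinal [kappa] is only required to be uncountable. *)
Definition monster (L : signature) (K : Type) (T : theory L) (C : structure L) : Prop :=
  [/\ ~ countable [set: K], models C T, saturated K C & homogeneous K C].

Record ctype (L : signature) (C : structure L) (I : Type) (A : set C) := CType {
  ctype_set : set (pformula I A);
  ctype_fin : finitely_satisfiable ctype_set;
  ctype_complete : forall phi, ctype_set phi \/ ctype_set (Neg phi) }.

HB.instance Definition _ (L : signature) (C : structure L) (I : Type) (A : set C) :=
  gen_eqMixin (ctype I A).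
HB.instance Definition _ (L : signature) (C : structure L) (I : Type) (A : set C) :=
  gen_choiceMixin (ctype I A).

HB.instance Definition _ (L : signature) (V : Type) := gen_eqMixin (formula L V).
HB.instance Definition _ (L : signature) (V : Type) := gen_choiceMixin (formula L V).
HB.instance Definition _ (L : signature) (V : Type) :=
  isPointed.Build (formula L V) Bot.

Lemma ctype_mem (L : signature) (C : structure L) (I : Type) (A : set C)
    (p : ctype I A) (D : set (pformula I A)) (phi : pformula I A) :
  D `<=` ctype_set p -> finite_set D ->
  (forall a, (forall psi, D psi -> psat psi a) -> psat phi a) -> ctype_set p phi.
Proof.
move=> Dp fD h; case: (ctype_complete p phi) => // np.
have [||a ha] := @ctype_fin _ _ _ _ p (Neg phi |` D).
- by move=> psi [->|/Dp].
- by rewrite finite_setU; split=> //; exact: finite_set1.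
- by case: (ha (Neg phi) (or_introl erefl)); apply: h => psi Dpsi; apply: ha; right.
Qed.

Definition stone_basic (L : signature) (C : structure L) (I : Type) (A : set C)
  (phi : formula L (I + A)%type) : set (ctype I A) := [set p : ctype I A | ctype_set p phi].

Lemma stone_cover (L : signature) (C : structure L) (I : Type) (A : set C) :
  \bigcup_(phi in [set: formula L (I + A)%type]) stone_basic phi = [set: ctype I A].
Proof.
apply/seteqP; split=> // p _; exists (Neg Bot) => //=.
apply: (@ctype_mem _ _ _ _ p set0); first exact: sub0set.
- exact: finite_set0.
- by move=> a _ /=; rewrite /psat.
Qed.

Lemma stone_join (L : signature) (C : structure L) (I : Type) (A : set C)
    (phi psi : formula L (I + A)%type) (p : ctype I A) :
  [set: formula L (I + A)%type] phi -> [set: formula L (I + A)%type] psi ->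
  stone_basic phi p -> stone_basic psi p ->
  exists chi, [/\ [set: formula L (I + A)%type] chi, stone_basic chi p
                & stone_basic chi `<=` stone_basic phi `&` stone_basic psi].
Proof.
move=> _ _ pphi ppsi; exists (Neg (Imp phi (Neg psi))); split=> //.
  apply: (@ctype_mem _ _ _ _ p [set phi; psi]).
  - by move=> _ [->|->].
  - by rewrite finite_setU; split; exact: finite_set1.
  - move=> a ha h; apply: (h _ _); first exact: (ha phi (or_introl erefl)).
    exact: (ha psi (or_intror erefl)).
move=> q qchi; split.
  apply: (@ctype_mem _ _ _ _ q [set Neg (Imp phi (Neg psi))]).
  - by move=> _ ->.
  - exact: finite_set1.
  - move=> a /(_ _ erefl) h; apply: contrapT => nphi.
    by apply: h => hphi.
apply: (@ctype_mem _ _ _ _ q [set Neg (Imp phi (Neg psi))]).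
- by move=> _ ->.
- exact: finite_set1.
- move=> a /(_ _ erefl) h; apply: contrapT => npsi.
  by apply: h => _ hpsi.
Qed.

HB.instance Definition _ (L : signature) (C : structure L) (I : Type) (A : set C) :=
  isBaseTopological.Build (ctype I A)
    (@stone_cover L C I A) (@stone_join L C I A).

Lemma tp_fin (L : signature) (C : structure L) (I : Type) (A : set C) (a : I -> C) :
  finitely_satisfiable [set phi : pformula I A | psat phi a].
Proof. by move=> D Dp _; exists a => phi /Dp. Qed.

Lemma tp_complete (L : signature) (C : structure L) (I : Type) (A : set C)
    (a : I -> C) (phi : pformula I A) : psat phi a \/ psat (Neg phi) a.
Proof. exact: lem. Qed.

Definition tp (L : signature) (C : structure L) (I : Type) (A : set C) (a : I -> C) :
  ctype I A := CType (@tp_fin L C I A a) (@tp_complete L C I A a).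

Definition type_definable (L : signature) (C : structure L) (I : Type) (A : set C)
    (D : set (I -> C)) : Prop :=
  exists p : set (pformula I A), D = [set a | realizes a p].

Definition pseudo_closed (L : signature) (K : Type) (C : structure L) (I : Type)
    (D : set (I -> C)) : Prop :=
  exists2 A : set C, small K A & type_definable A D.

Definition pseudo_open (L : signature) (K : Type) (C : structure L) (I : Type)
    (D : set (I -> C)) : Prop := pseudo_closed K (~` D).

Definition pseudo_Gdelta (L : signature) (K : Type) (C : structure L) (I : Type)
    (D : set (I -> C)) : Prop :=
  exists2 F : nat -> set (I -> C),
    forall n, pseudo_open K (F n) & D = \bigcap_n F n.

Definition pseudo_Fsigma (L : signature) (K : Type) (C : structure L) (I : Type)
    (D : set (I -> C)) : Prop :=
  exists2 F : nat -> set (I -> C),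
    forall n, pseudo_closed K (F n) & D = \bigcup_n F n.

Definition aut_invariant (L : signature) (C : structure L) (I : Type)
    (D : set (I -> C)) : Prop :=
  forall s : C -> C, automorphism s -> forall a, D a <-> D (fun i => s (a i)).

Record countable_ordinal := CountableOrdinal {
  ord_carrier :> Type;
  ord_le : rel ord_carrier;
  ord_wo : well_order ord_le;
  ord_countable : countable [set: ord_carrier] }.

(* The operations are total functions; only their values on [H] matter. *)
Definition is_group (U : Type) (H : set U) (mul : U -> U -> U) (one : U)
    (inv : U -> U) : Prop :=
  [/\ H one,
      forall g h, H g -> H h -> H (mul g h),
      forall g, H g -> H (inv g),
      forall g h k, H g -> H h -> H k -> mul g (mul h k) = mul (mul g h) k
    & forall g, H g -> [/\ mul one g = g, mul g one = g,
                           mul (inv g) g = one & mul g (inv g) = one]].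

Definition is_subgroup (U : Type) (H : set U) (mul : U -> U -> U) (one : U)
    (inv : U -> U) (G : set U) : Prop :=
  [/\ G `<=` H, G one, forall g h, G g -> G h -> G (mul g h)
    & forall g, G g -> G (inv g)].

Definition is_action (U W : Type) (H : set U) (mul : U -> U -> U) (one : U)
    (X : set W) (act : U -> W -> W) : Prop :=
  [/\ forall g x, H g -> X x -> X (act g x),
      forall x, X x -> act one x = x
    & forall g h x, H g -> H h -> X x -> act g (act h x) = act (mul g h) x].

(* The graph of [op] on [P * Q], as a set of tuples indexed by [I + (J + J')]. *)
Definition graph2 (U I J J' : Type) (P : set (I -> U)) (Q : set (J -> U))
    (op : (I -> U) -> (J -> U) -> (J' -> U)) : set ((I + (J + J'))%type -> U) :=
  [set t | [/\ P (fun i => t (inl i)), Q (fun j => t (inr (inl j)))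
             & op (fun i => t (inl i)) (fun j => t (inr (inl j)))
               = (fun j => t (inr (inr j)))]].

Record Fsigma_action (L : signature) (K : Type) (C : structure L)
    (alpha beta : countable_ordinal) := FsigmaAction {
  actH : set (beta -> C);
  amul : (beta -> C) -> (beta -> C) -> (beta -> C);
  aone : beta -> C;
  ainv : (beta -> C) -> (beta -> C);
  actG : set (beta -> C);
  actV : nat -> set (beta -> C);
  actX : set (alpha -> C);
  aact : (beta -> C) -> (alpha -> C) -> (alpha -> C);
  actH_group : is_group actH amul aone ainv;
  actH_def : type_definable set0 actH;
  amul_def : type_definable set0 (graph2 actH actH amul);
  actG_subgroup : is_subgroup actH amul aone ainv actG;
  actG_inv : aut_invariant actG;
  actG_Fsigma : pseudo_Fsigma K actG;
  actG_V : actG = \bigcup_n actV n;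
  actV_def : forall n, type_definable set0 (actV n);
  actV_one : forall n, actV n aone;
  actV_sym : forall n, actV n = [set ainv g | g in actV n];
  actV_mul : forall n g h, actV n g -> actV n h -> actV n.+1 (amul g h);
  actX_def : type_definable set0 actX;
  aact_action : is_action actH amul aone actX aact;
  aact_def : type_definable set0 (graph2 actH actX aact) }.

Section FsigmaActionTheory.
Context {L : signature} {K : Type} {C : structure L} {alpha beta : countable_ordinal}.
Context (S : Fsigma_action K C alpha beta).

Definition actU (n : nat) : set ((alpha -> C) * (alpha -> C)) :=
  [set ab | [/\ actX S ab.1, actX S ab.2
              & exists2 g, actV S n g & aact S g ab.1 = ab.2]].

Definition orbit_eq : set ((alpha -> C) * (alpha -> C)) := \bigcup_n actU n.

Definition bounded_action : Prop :=
  small K [set [set y | orbit_eq (x, y)] | x in actX S].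

Definition Gorbit (a : alpha -> C) : set (alpha -> C) :=
  [set aact S g a | g in actG S].

Definition right_shifty (a : alpha -> C) : Prop :=
  forall k : nat, exists n : nat, forall g1 g2, actH S g1 -> actH S g2 ->
    actU k (aact S g1 a, aact S g2 a) ->
    actU n (aact S (amul S g1 (ainv S g2)) a, a).

Definition left_shifty (a : alpha -> C) : Prop :=
  forall k : nat, exists n : nat, forall g1 g2, actH S g1 -> actH S g2 ->
    (actU k (aact S g1 a, aact S g2 a) ->
     actU n (aact S (amul S (ainv S g1) g2) a, a)) /\
    (actU k (aact S (amul S (ainv S g1) g2) a, a) ->
     actU n (aact S g1 a, aact S g2 a)).

Definition shifty (a : alpha -> C) : Prop :=
  actX S a /\ (right_shifty a \/ left_shifty a).

Definition strongly_closed_on (Z : set (alpha -> C)) : Prop :=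
  exists n : nat, orbit_eq `&` (Z `*` Z) = actU n `&` (Z `*` Z).

End FsigmaActionTheory.

Definition borel_function (U W : topologicalType) (f : U -> W) : Prop :=
  forall B, <<s @open W >> B -> <<s @open U >> (f @^-1` B).

Definition types_of (L : signature) (C : structure L) (I : Type) (M : set C)
  (Z : set (I -> C)) : set (ctype I M) := [set tp M a | a in Z].

Arguments types_of {L C I} M Z.

Definition rel_on_types (L : signature) (C : structure L) (I : Type) (M : set C)
    (E : set ((I -> C) * (I -> C))) (p q : ctype I M) : Prop :=
  exists a b, [/\ realizes a (ctype_set p), realizes b (ctype_set q) & E (a, b)].

(* [types_of M Y], used as a type, carries the topology induced from the Stone
   space. By the independence of the countable model, smoothness is stated with
   an existential quantifier over it. *)
Definition smooth (L : signature) (C : structure L) (I : Type)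
    (E : set ((I -> C) * (I -> C))) (Y : set (I -> C)) : Prop :=
  exists M : set C, [/\ elementary_submodel M, countable M
    & exists2 f : types_of M Y -> cantor_space, borel_function f
      & forall p q : types_of M Y,
          rel_on_types E (set_val p) (set_val q) <-> f p = f q].

(* Main.v *)
From Stdlib Require List.
Require Import Defs.
From mathcomp Require Import all_boot.
From mathcomp Require Import boolp classical_sets functions cardinality filter.
From mathcomp Require Import topology cantor measurable_structure.

(** Idea. Let [M] be a countable model witnessing smoothness, through a Borel
    reduction [f] of the relation on types over [M] to equality.

    Since the orbit of the shifty point [a] is not strongly closed, there are
    elements of [G] moving [a] arbitrarily far. On a countable subgroup [Gam]
    containing such elements, the ultrafilters concentrating on far elements
    form a closed subsemigroup, hence contain an idempotent [u]. Let [h] be a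
    limit of [u] over a countable set [A] containing [M], [a] and [Gam], and put
    [x = h a]. Idempotence gives [h' h a] and [h a] the same type over [A] for a
    further limit [h'], so by boundedness these are equivalent, and shiftiness
    turns this into [x] being in the orbit of [a]. Moreover every neighbourhood
    of [x] over [A] contains points [g x] with [g] in [Gam] arbitrarily far
    from [x].

    Let [Z] be the closure over [A] of the [Gam]-orbit of [x], intersected with
    [Y]. It is a Baire space on which [Gam] acts topologically transitively, so
    the invariant Borel function [f] is constant on a comeager set: some class
    is comeager in [Z]. The sets [U n (b, -)] cover the class of [b], so one of
    them is dense in a nonempty open set, which meets the [Gam]-orbit of [x];
    hence the comeager class is that of [a]. As [a] lies in [A], the sets
    [U n (a, -)] are closed over [A], and one of them contains an open set
    meeting the [Gam]-orbit of [x]. This bounds the distance of the points of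
    the [Gam]-orbit near [x] from [x], contradicting recurrence. *)

Set Implicit Arguments.
Unset Strict Implicit.
Unset Printing Implicit Defensive.

Local Open Scope classical_set_scope.
Local Open Scope card_scope.

(** * Formulas and definable sets *)

Section Formulas.
Context {L : signature}.

Fixpoint trename (V W : Type) (r : V -> W) (t : term L V) : term L W :=
  match t with
  | Var x => Var L (r x)
  | App f ts => App (fun i => trename r (ts i))
  end.

Fixpoint frename (V : Type) (phi : formula L V) :
    forall W : Type, (V -> W) -> formula L W :=
  match phi with
  | Bot => fun W r => Bot
  | Equ t1 t2 => fun W r => Equ (trename r t1) (trename r t2)
  | Rel R ts => fun W r => Rel (fun i => trename r (ts i))
  | Imp phi1 phi2 => fun W r => Imp (frename phi1 r) (frename phi2 r)
  | All phi1 => fun W r => All (frename phi1 (omap r))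
  end.

Lemma teval_rename (M : structure L) (V W : Type) (r : V -> W) (t : term L V)
    (v : W -> M) : teval v (trename r t) = teval (fun x => v (r x)) t.
Proof. by elim: t => //= f ts IH; congr fint; apply: funext. Qed.

Lemma sat_rename (M : structure L) (V : Type) (phi : formula L V) (W : Type)
    (r : V -> W) (v : W -> M) :
  sat (frename phi r) v = sat phi (fun x => v (r x)).
Proof.
elim: phi W r v => {V} [V W r v|V t1 t2 W r v|V R ts W r v|V p1 IH1 p2 IH2 W r v
  |V p IH W r v] //=.
- by rewrite !teval_rename.
- by congr rint; apply: funext => i; rewrite teval_rename.
- by rewrite IH1 IH2.
- apply: eq_forall => x; rewrite IH; congr (sat p); apply: funext; by case.
Qed.

Lemma teval_support (V : Type) (t : term L V) : exists s : set V, finite_set s /\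
  forall (M : structure L) (v w : V -> M), (forall x, s x -> v x = w x) ->
    teval v t = teval w t.
Proof.
elim: t => [x|f ts IH].
  by exists [set x]; split=> [|M v w h]; [exact: finite_set1|exact: h].
have [s hs] := choice IH.
exists (\bigcup_i s i); split.
  by apply: bigcup_finite; [exact: finite_finset|move=> i _; case: (hs i)].
move=> M v w h /=; congr fint; apply: funext => i; apply: (hs i).2 => x sx.
by apply: h; exists i.
Qed.

(** Arities are finite, so a formula over an arbitrary variable type reads only finitely many
    variables, the same ones in every structure. *)
Lemma sat_support (V : Type) (phi : formula L V) :
  exists s : set V, finite_set s /\
  forall (M : structure L) (v w : V -> M), (forall x, s x -> v x = w x) ->
    sat phi v = sat phi w.
Proof.
elim: phi => {V} [V|V t1 t2|V R ts|V p1 [s1 [f1 h1]] p2 [s2 [f2 h2]]|V p [s [f h]]].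
- by exists set0; split=> //; exact: finite_set0.
- have [s1 [f1 h1]] := teval_support t1; have [s2 [f2 h2]] := teval_support t2.
  exists (s1 `|` s2); rewrite finite_setU; split=> // M v w h /=.
  by rewrite (h1 _ v w) ?(h2 _ v w) // => x sx; apply: h; [right|left].
- have [s hs] := choice (fun i => teval_support (ts i)).
  exists (\bigcup_i s i); split.
    by apply: bigcup_finite; [exact: finite_finset|move=> i _; case: (hs i)].
  move=> M v w h /=; congr rint; apply: funext => i; apply: (hs i).2 => x sx.
  by apply: h; exists i.
- exists (s1 `|` s2); rewrite finite_setU; split=> // M v w h /=.
  by rewrite (h1 _ v w) ?(h2 _ v w) // => x sx; apply: h; [right|left].
- exists (some @^-1` s); split.
    by apply: finite_preimage => // x y _ _ [].
  move=> M v w hs /=; apply: eq_forall => x; apply: h => -[y|] //= sy.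
  exact: hs.
Qed.

Definition upd (V U : Type) (v : V -> U) (i : V) (x : U) : V -> U :=
  fun j => if pselect (j = i) then x else v j.

(** Quantifies [i] without leaving the variable type [V]: [i] is renamed to the bound [None] and
    survives as a dummy variable, so quantifiers can be iterated along a list. *)
Definition Ex (V : Type) (i : V) (phi : formula L V) : formula L V :=
  Neg (All (Neg (frename phi (fun j => if pselect (j = i) then None else Some j)))).

Lemma sat_Ex (M : structure L) (V : Type) (i : V) (phi : formula L V) (v : V -> M) :
  sat (Ex i phi) v <-> exists x, sat phi (upd v i x).
Proof.
have E x : sat (frename phi (fun j => if pselect (j = i) then None else Some j))
    (vcons x v) = sat phi (upd v i x).
  rewrite sat_rename; congr (sat phi); apply: funext => j; rewrite /upd.
  by case: pselect.
split=> /= [h|[x hx] h].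
  apply: contrapT => hn; apply: h => x; rewrite E => hx; apply: hn; by exists x.
by apply: (h x); rewrite E.
Qed.

Lemma sat_Exs (M : structure L) (V : Type) (s : seq V) (phi : formula L V) (v : V -> M) :
  sat (foldr (@Ex V) phi s) v <->
  exists w, (forall x, ~ List.In x s -> w x = v x) /\ sat phi w.
Proof.
elim: s v => [|i s IH] v; rewrite [foldr _ _ _]/=.
  split=> [h|[w [wv h]]]; first by exists v.
  by rewrite (_ : v = w) //; apply: funext => x; rewrite wv.
rewrite sat_Ex; split=> [[x /IH[w [hw h]]]|[w [hw h]]].
  exists w; split=> // y hy; rewrite hw; last by move=> ys; apply: hy; right.
  by rewrite /upd; case: pselect => // yi; case: hy; left.
exists (w i); apply/IH; exists w; split=> // y ys; rewrite /upd.
case: pselect => [yi|yi]; first by rewrite [in LHS]yi.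
by rewrite hw // => -[iy|//]; apply: yi.
Qed.

End Formulas.

Lemma finite_set_In (V : Type) (s : set V) : finite_set s ->
  exists l : seq V, forall x, s x <-> List.In x l.
Proof.
elim/Pchoice: V s => V s /finite_seqP[l ->]; exists l => x /=.
elim: l => //= y l IH; rewrite in_cons; split.
  by case/orP => [/eqP->|/IH]; [left|right].
by case=> [->|/IH ->]; rewrite ?eqxx ?orbT.
Qed.

(** * Definable sets, type definable sets and equality of types *)

Section Definable.
Context {L : signature} {C : structure L}.
Implicit Types (A B : set C).

Definition fdef (I : Type) A (D : set (I -> C)) :=
  exists phi : pformula I A, D = psat phi.

(** An element of [I + C] describes an entry of a tuple: a coordinate of the variable tuple or a
    constant. Substituting such descriptions covers renaming, identification of variables and
    insertion of parameters. *)
Definition pval (I : Type) (x : I -> C) (o : I + C) : C :=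
  match o with inl i => x i | inr c => c end.

Definition param_in (I : Type) A (o : I + C) : Prop :=
  match o with inl i => True | inr c => A c end.

Lemma fdefC (I : Type) A (D : set (I -> C)) : fdef A D -> fdef A (~` D).
Proof. by case=> phi ->; exists (Neg phi). Qed.

Lemma fdefT (I : Type) A : fdef A [set: I -> C].
Proof.
by exists (Neg Bot); apply/seteqP; split=> // x _; rewrite /psat.
Qed.

Lemma fdefI (I : Type) A (D D' : set (I -> C)) :
  fdef A D -> fdef A D' -> fdef A (D `&` D').
Proof.
move=> [phi ->] [psi ->]; exists (Neg (Imp phi (Neg psi))).
rewrite /psat; apply/seteqP; split=> x /=.
  by move=> [h1 h2] h; apply: h.
move=> h; split; apply: contrapT => hn; apply: h => // hx; by [].
Qed.

Lemma fdef_subst (I J : Type) A B (D : set (J -> C)) (r : J -> I + C) :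
  fdef A D -> A `<=` B -> (forall j, param_in B (r j)) ->
  fdef B [set x | D (fun j => pval x (r j))].
Proof.
move=> [phi ->] AB rB.
have lift (o : I + C) : param_in B o -> {o' : I + B | forall x,
    pval x o = match o' with inl i => x i | inr c => set_val c end}.
  case: o => [i _|c Bc]; first by exists (inl i).
  by exists (inr (exist _ c (mem_set Bc))) => x; rewrite /= set_valE.
pose s (o : J + A) : I + B := match o with
  | inl j => sval (lift _ (rB j))
  | inr c => inr (exist _ (set_val c) (mem_set (AB _ (set_valP c)))) end.
exists (frename phi s); apply/seteqP; split=> x /=; rewrite /psat sat_rename;
  (suff -> : (fun o => match s o with inl i => x i | inr c => set_val c end) =
     (fun o => match o with inl j => pval x (r j) | inr c => set_val c end) by []);
  apply: funext => -[j|c] //=; by rewrite -(svalP (lift _ (rB j))).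
Qed.

Lemma fdefS (I : Type) A B (D : set (I -> C)) : fdef A D -> A `<=` B -> fdef B D.
Proof. by move=> h AB; apply: (@fdef_subst _ _ _ _ _ inl h AB). Qed.

Lemma fdef_eq (I : Type) A (o o' : I + C) : param_in A o -> param_in A o' ->
  fdef A [set x : I -> C | pval x o = pval x o'].
Proof.
move=> ho ho'.
have h : @fdef bool set0 [set x | x true = x false].
  by exists (Equ (Var L (inl true)) (Var L (inl false))).
by apply: (@fdef_subst _ _ _ _ _ (fun b => if b then o else o') h) => // -[].
Qed.

Lemma fdef_support (I : Type) A (D : set (I -> C)) : fdef A D ->
  exists s : set I, finite_set s /\
  forall x y, (forall i, s i -> x i = y i) -> D x -> D y.
Proof.
move=> [phi ->]; have [s [fs hs]] := sat_support phi.
exists (inl @^-1` s); split; first by apply: finite_preimage => // x y _ _ [].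
move=> x y xy; rewrite /psat => h; erewrite hs; first exact: h.
by move=> [i si|c] //; rewrite xy.
Qed.

(** A form free of syntax, where a point outside the set is separated from it by a definable set. It
    passes directly to limits and to points of equal type. *)
Lemma type_definableP (I : Type) A (D : set (I -> C)) : type_definable A D <->
  forall x, (forall E, fdef A E -> D `<=` E -> E x) -> D x.
Proof.
split=> [[p ->] x h phi pphi|h].
  by apply: (h (psat phi)); [exists phi|move=> y; apply].
exists [set phi | D `<=` psat phi]; apply/seteqP; split=> x; first by move=> Dx phi; apply.
by move=> hx; apply: h => E [phi ->] DE; apply: hx.
Qed.

Lemma type_definable_subst (I J : Type) A B (D : set (J -> C)) (r : J -> I + C) :
  type_definable A D -> A `<=` B -> (forall j, param_in B (r j)) ->
  type_definable B [set x | D (fun j => pval x (r j))].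
Proof.
move=> hD AB rB; apply/type_definableP => x h; apply: (proj1 (type_definableP _ _) hD).
by move=> E hE DE; apply: (h _ (fdef_subst hE AB rB)) => y; apply: DE.
Qed.

Lemma type_definableS (I : Type) A B (D : set (I -> C)) :
  type_definable A D -> A `<=` B -> type_definable B D.
Proof. by move=> h AB; apply: (@type_definable_subst _ _ _ _ _ inl h AB). Qed.

(** One implication suffices, since definable sets are closed under complement. *)
Definition eqtp (I : Type) A (x y : I -> C) := forall D, fdef A D -> D x -> D y.

Lemma eqtp_iff (I : Type) A (x y : I -> C) D : eqtp A x y -> fdef A D -> (D x <-> D y).
Proof.
move=> h hD; split; first exact: h.
by move=> Dy; apply: contrapT => nDx; apply: (h _ (fdefC hD)).
Qed.

Lemma eqtp_sym (I : Type) A (x y : I -> C) : eqtp A x y -> eqtp A y x.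
Proof. by move=> h D hD /(eqtp_iff h hD). Qed.

Lemma eqtp_trans (I : Type) A (x y z : I -> C) : eqtp A x y -> eqtp A y z -> eqtp A x z.
Proof. by move=> h h' D hD /(h _ hD)/(h' _ hD). Qed.

Lemma eqtp_td (I : Type) A (x y : I -> C) D :
  eqtp A x y -> type_definable A D -> D x -> D y.
Proof.
move=> h /type_definableP hD Dx; apply: hD => E hE DE.
by apply: (h _ hE); apply: DE.
Qed.

Lemma eqtpS (I : Type) A B (x y : I -> C) : A `<=` B -> eqtp B x y -> eqtp A x y.
Proof. by move=> AB h D hD; apply: h; apply: fdefS hD AB. Qed.

Lemma eqtp_tp (I : Type) A (x y : I -> C) : realizes y (ctype_set (tp A x)) <-> eqtp A x y.
Proof.
split=> [h D [phi ->] hx|h phi hx]; first exact: h.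
by apply: (h (psat phi)) => //; exists phi.
Qed.

End Definable.

(** * Cardinalities *)

Lemma countable_setU (U : Type) (A B : set U) :
  countable A -> countable B -> countable (A `|` B).
Proof.
move=> cA cB; rewrite -bigcup2E; apply: bigcup_countable => [|[|[|i]] _ //=].
exact: countableP.
Qed.

Lemma countable_range (I U : Type) (x : I -> U) :
  countable [set: I] -> countable (range x).
Proof. by move=> cI; apply: sub_countable cI; exact: card_image_le. Qed.

Lemma countable_sum (I J : Type) : countable [set: I] -> countable [set: J] ->
  countable [set: I + J].
Proof.
move=> /countable_injP[e ei] /countable_injP[f fi]; apply/countable_injP.
exists (fun o => match o with inl i => (e i).*2 | inr j => (f j).*2.+1 end).
move=> [i|j] [i'|j'] _ _.
- by move=> /double_inj/ei ->//; rewrite inE.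
- by move=> /(congr1 odd); rewrite /= !odd_double.
- by move=> /(congr1 odd); rewrite /= !odd_double.
- by move=> [] /double_inj/fi ->//; rewrite inE.
Qed.

Lemma inj_card_leP (T U : Type) (A : set T) (B : set U) (f : T -> U) :
  {in A &, injective f} -> (forall x, A x -> B (f x)) -> A #<= B.
Proof.
move=> fi fAB; apply: (@card_le_trans _ _ _ (f @` A)).
  have : f @` A #= A by exact: inj_card_eq.
  by rewrite card_eq_le => /andP[].
by apply: subset_card_le => _ [x Ax <-]; exact: fAB.
Qed.

Lemma card_le_inj (T U : Type) (A : set T) (B : set U) : A #<= B -> A !=set0 ->
  exists f : T -> U, {in A &, injective f} /\ forall x, A x -> B (f x).
Proof.
elim/Ppointed: U B => [U|U] B.
  by rewrite [B]emptyE card_le0 => /eqP -> [].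
move=> /pcard_leP[f] _; exists f; split; first exact: inj.
by move=> x Ax; exact: funS.
Qed.

Lemma infinite_inj (U : Type) (A : set U) : infinite_set A ->
  exists f : nat -> U, injective f /\ forall n, A (f n).
Proof.
move=> /infiniteP h; have [|f [fi fA]] := card_le_inj h; first by exists 0.
by exists f; split=> [x y|n]; [apply: fi; rewrite inE|apply: fA].
Qed.

(** Hilbert's hotel: a copy of [nat] inside [A], together with [B], is countable and is injected
    back into that copy, while all other points stay fixed. *)
Lemma card_setU_countable (U : Type) (A B : set U) :
  ~ countable A -> countable B -> A `|` B #<= A.
Proof.
move=> nA cB; have [f [fi fA]] : exists f : nat -> U, injective f /\ forall n, A (f n).
  by apply: infinite_inj => /finite_set_countable.
have [c ci] : exists c : U -> nat, {in range f `|` B &, injective c}.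
  apply/countable_injP; apply: countable_setU => //.
  by apply: countable_range; exact: countableP.
pose g x := if pselect ((range f `|` B) x) is left _ then f (c x) else x.
apply: (@inj_card_leP _ _ _ _ g); last first.
  move=> x ABx; rewrite /g; case: pselect => // h.
  by case: ABx => // Bx; case: h; right.
move=> x y _ _; rewrite /g; case: pselect => hx; case: pselect => hy //.
- by move/fi; apply: ci; rewrite inE.
- by move=> e; case: hy; left; exists (c x).
- by move=> e; case: hx; left; exists (c y).
Qed.

Lemma small_le (K U W : Type) (A : set U) (B : set W) :
  B #<= A -> small K A -> small K B.
Proof.
move=> BA [AK KA]; split; first exact: card_le_trans BA AK.
by move=> KB; apply: KA; apply: card_le_trans KB BA.
Qed.

Lemma small_countable (K U : Type) (A : set U) : ~ countable [set: K] ->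
  countable A -> small K A.
Proof.
move=> nK cA; split; last by move=> KA; apply: nK; apply: sub_countable KA cA.
apply: card_le_trans cA _; apply/infiniteP.
by move=> /finite_set_countable.
Qed.

Lemma small_setU (K U : Type) (A B : set U) : ~ countable [set: K] ->
  small K A -> countable B -> small K (A `|` B).
Proof.
move=> nK sA cB; case: (pselect (countable A)) => cA; last first.
  exact: small_le (card_setU_countable cA cB) sA.
by apply: small_countable => //; exact: countable_setU.
Qed.

(** For uncountable [A], Zorn partitions [A], up to a finite remainder, into countably infinite
    blocks, and a pairing function makes room for countably many copies inside each block. *)
Lemma card_setX_nat (U : Type) (A : set U) : infinite_set A ->
  A `*` [set: nat] #<= A.
Proof.
move=> iA; case: (pselect (countable A)) => cA.
  apply: (@card_le_trans _ _ _ [set: nat]); last exact/infiniteP.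
  exact: countableX.
pose D := [set P | P `<=` A /\ exists f : nat -> U, injective f /\ P = range f].
have [E [ED tE maxE]] := @ex_maximal_disjoint_subcollection _ _ id D.
pose W := \bigcup_(P in E) P.
have WA : W `<=` A by move=> x [P /ED[PA _] Px]; exact: PA.
(* An infinite remainder would contain a further block, against the maximality of [E]. *)
have finR : finite_set (A `\` W).
  apply: contrapT => /infinite_inj[f [fi fR]].
  have fW n P : E P -> ~ P (f n) by move=> EP Pf; apply: (fR n).2; exists P.
  have nE : ~ E (range f) by move=> /fW h; apply: (h 0); exists 0.
  apply: (maxE (range f |` E)).
  - split; first by move=> P EP; right.
    by move=> /(_ (range f)) h; apply: nE; apply: h; left.
  - move=> P [->|/ED//]; split; first by move=> _ [n _ <-]; exact: (fR n).1.
    by exists f.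
  - move=> P Q [->|EP] [->|EQ] //; last exact: tE.
      by move=> [x [[n _ <-] Qx]]; case: (fW n _ EQ).
    by move=> [x [Px [n _ xe]]]; case: (fW n _ EP); rewrite xe.
have cW : ~ countable W.
  move=> cW; apply: cA; rewrite -(setDUK WA); apply: countable_setU => //.
  exact: finite_set_countable.
have AW : A #<= W.
  by rewrite -{1}(setDUK WA); apply: card_setU_countable => //; exact: finite_set_countable.
have [f [fi fW]] : exists f : U -> U, {in A &, injective f} /\ forall x, A x -> W (f x).
  by apply: card_le_inj AW _; exact: infinite_setN0.
have /choice[en hen] : forall P : set U, exists e : nat -> U, E P -> injective e /\ P = range e.
  move=> P; case: (pselect (E P)) => [/ED[_ [e h]]|nE]; first by exists e.
  have [e [ei _]] := infinite_inj iA; by exists e.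
have /choice[q hq] : forall x, exists q : set U * nat, W x -> E q.1 /\ en q.1 q.2 = x.
  move=> x; case: (pselect (W x)) => [[P EP Px]|nW]; last by exists (set0, 0).
  have [ei Pe] := hen _ EP; move: (Px); rewrite Pe => -[n _ ex].
  by exists (P, n).
(* [q] gives the block of a point and its position there. The pair [(x, n)] goes to the block of
   [f x], at the position coding the position of [f x] together with [n]. *)
pose g (xn : U * nat) := en (q (f xn.1)).1 (pickle ((q (f xn.1)).2, xn.2)).
apply: (@inj_card_leP _ _ _ _ g).
  move=> [x n] [y m]; rewrite !inE /g => -[/= Ax _] [/= Ay _] e.
  have [Ex ex] := hq _ (fW _ Ax); have [Ey ey] := hq _ (fW _ Ay).
  have eP : (q (f x)).1 = (q (f y)).1.
    apply: tE => //; exists (en (q (f x)).1 (pickle ((q (f x)).2, n))); split.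
      by rewrite [X in X _](hen _ Ex).2; eexists.
    by rewrite [X in X _](hen _ Ey).2 e; eexists.
  move: e; rewrite eP => /((hen _ Ey).1)/(pcan_inj pickleK)[e2 ->]; congr (_, _).
  apply: fi; rewrite ?inE // -ex -ey; by rewrite eP e2.
move=> [x n] [/= Ax _]; have [Ex ex] := hq _ (fW _ Ax).
by apply: WA; exists (q (f x)).1 => //; rewrite [X in X _](hen _ Ex).2; eexists.
Qed.

(** * Saturation and homogeneity in countably many variables *)

(** Convergence in the Stone space over [A], the limit type being given by a realization. Along an
    ultrafilter the limit is unique only up to its type over [A]. *)
Definition ulim (L : signature) (C : structure L) (W I : Type) (F : set_system W)
    (u : W -> I -> C) (A : set C) (x : I -> C) : Prop :=
  forall D, fdef A D -> F (u @^-1` D) -> D x.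

Section Monster.
Context {L : signature} {K : Type} {C : structure L}.
Context (nK : ~ countable [set: K]) (satC : saturated K C) (homC : homogeneous K C).
Implicit Types (A B : set C).

(** Saturation realizes types in one variable, so a limit of infinite tuples is built coordinate by
    coordinate along [e]. The hypothesis says that the first [n] values are consistent with every
    formula holding along [F]. *)
Lemma ulim_step (I : Type) (e : I -> nat) A (W : Type) (F : set_system W)
    (u : W -> I -> C) (n : nat) (x : I -> C) :
  injective e -> small K A -> ProperFilter F ->
  (forall D, fdef A D -> F (u @^-1` D) ->
     exists y, (forall i, e i < n -> y i = x i) /\ D y) ->
  exists x', (forall i, e i < n -> x' i = x i) /\
    forall D, fdef A D -> F (u @^-1` D) ->
     exists y, (forall i, e i < n.+1 -> y i = x' i) /\ D y.
Proof.
move=> ei sA FF hx; case: (pselect (exists i, e i = n)) => [[i0 ei0]|ne]; last first.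
  exists x; split=> // D hD FD; have [y [yx Dy]] := hx _ hD FD; exists y; split=> // i.
  rewrite ltnS leq_eqVlt => /orP[/eqP ein|]; last exact: yx.
  by case: ne; exists i.
pose A' := A `|` [set x i | i in [set i | e i < n]].
pose ext (z : C) i := if pselect (e i < n) is left _ then x i else z.
(* [Q D] collects the values at [i0] that extend the earlier values of [x] to a member of [D]. It is
   definable over [A'], because only the finitely many later coordinates in the support of [D] need
   a quantifier. *)
pose Q (D : set (I -> C)) := [set z : unit -> C |
  exists y, (forall i, e i < n.+1 -> y i = upd x i0 (z tt) i) /\ D y].
have defQ D : fdef A D -> fdef A' (Q D).
  move=> hD; have [phi De] := hD; have [s [fs hs]] := fdef_support hD.
  have [l hl] := finite_set_In (sub_finite_set (@subIsetl _ s [set i | n < e i]) fs).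
  pose r i : unit + C := if pselect (e i < n) is left _ then inr (x i) else inl tt.
  have hr i : param_in A' (r i) by rewrite /r; case: pselect => //= h; right; exists i.
  have h : fdef A [set y | exists y', (forall i, ~ List.In i l -> y' i = y i) /\ D y'].
    exists (foldr (@Ex L _) phi (map inl l)); apply/seteqP; split=> y /=.
      move=> [y' [yy']]; rewrite De /psat => Dy'; apply/sat_Exs; eexists; split; last exact: Dy'.
      move=> [i|c] //= hi; apply: yy' => il; apply: hi; exact: List.in_map.
    rewrite /psat => /sat_Exs[w [hw Dw]]; exists (fun i => w (inl i)); split.
      move=> i il; rewrite hw // => /List.in_map_iff[j [[->]]]; exact: il.
    rewrite De /psat; suff -> : (fun o : I + A => match o with
      inl i => w (inl i) | inr c => set_val c end) = w by [].
    apply: funext => -[i|c] //; rewrite hw // => /List.in_map_iff[j []] //.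
  have := fdef_subst h (@subsetUl _ _ _) hr; rewrite -/A'.
  suff -> : [set x0 | [set y | exists y', (forall i, ~ List.In i l -> y' i = y i) /\ D y']
     (fun j => pval x0 (r j))] = Q D by [].
  have rE (z : unit -> C) i : e i < n.+1 -> pval z (r i) = upd x i0 (z tt) i.
    rewrite ltnS leq_eqVlt /r /upd => /orP[/eqP ein|ein]; case: pselect => [h1|h1] //=.
    - by rewrite ein ltnn in h1.
    - by case: pselect => // ni; case: ni; apply: ei; rewrite ein.
    - by case: pselect => // ii; rewrite ii ei0 ltnn in ein.
  apply/seteqP; split=> z /= [y [hy Dy]].
    exists y; split=> // i ein; rewrite hy ?rE // => /hl[_ /=].
    by rewrite ltnNge -ltnS ein.
  exists (fun i => if pselect (List.In i l) is left _ then y i else pval z (r i)); split.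
    by move=> i; case: pselect.
  apply: (hs y) => // i si; case: pselect => // il; rewrite rE ?hy //.
    by rewrite ltnS leqNgt; apply/negP => h1; apply: il; apply/hl.
  by rewrite ltnS leqNgt; apply/negP => h1; apply: il; apply/hl.
have sA' : small K A'.
  apply: small_setU => //; apply: finite_set_countable; apply: finite_image.
  have : finite_set (`I_n) by exact: finite_II.
  by move=> /(@finite_preimage _ _ _ e); apply; move=> i j _ _; apply: ei.
pose q : set (pformula unit A') := [set th |
  exists D, [/\ fdef A D, F (u @^-1` D) & Q D `<=` psat th]].
have [|z hz] := satC (p := q) sA'.
  move=> D Dq fD.
  have /choice[G hG] : forall th, exists G, D th ->
      [/\ fdef A G, F (u @^-1` G) & Q G `<=` psat th].
    move=> th; case: (pselect (D th)) => [/Dq[G hG]|nD]; first by exists G.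
    by exists set0.
  have [ls Ds] : exists l : seq (pformula unit A'), D = [set` l] by apply/finite_seqP.
  have {}hG th : th \in ls -> [/\ fdef A (G th), F (u @^-1` G th) & Q (G th) `<=` psat th].
    by move=> h; apply: hG; rewrite Ds.
  have [H [H1 H2 H3]] : exists H, [/\ fdef A H, F (u @^-1` H) & forall th, th \in ls -> H `<=` G th].
    elim: (ls) hG => [|th l IH] hG.
      by exists setT; split=> //; [exact: fdefT|exact: filterT].
    have [|H [H1 H2 H3]] := IH; first by move=> t tl; apply: hG; rewrite inE tl orbT.
    have [G1 G2 _] := hG th (mem_head _ _).
    exists (G th `&` H); split; [exact: fdefI|exact: filterI|].
    by move=> t; rewrite inE => /orP[/eqP->|/H3 h] y [Gy Hy] //; apply: h.
  have [y [yx Hy]] := hx _ H1 H2.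
  exists (fun=> y i0) => th; rewrite Ds /= => thl; have [_ _ h] := hG _ thl.
  apply: h; exists y; split; last exact: H3.
  move=> i; rewrite ltnS leq_eqVlt /upd => /orP[/eqP ein|ein]; case: pselect => // ii.
  - by rewrite [in LHS]ii.
  - by case: ii; apply: ei; rewrite ein.
  - by rewrite ii ei0 ltnn in ein.
  - exact: yx.
exists (upd x i0 (z tt)); split.
  by move=> i ein; rewrite /upd; case: pselect => // ii; rewrite ii ei0 ltnn in ein.
move=> D hD FD; have [th hth] := defQ _ hD.
have : psat th z by apply: hz; exists D; split=> //; rewrite hth.
by rewrite -hth.
Qed.

Lemma ulim_exists (I : Type) A (W : Type) (F : set_system W) (u : W -> I -> C) :
  countable [set: I] -> small K A -> ProperFilter F -> exists x, ulim F u A x.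
Proof.
move=> /countable_injP[e ei] sA FF; have {}ei : injective e.
  by move=> i j; apply: ei; rewrite inE.
pose J (n : nat) (x : I -> C) := forall D, fdef A D -> F (u @^-1` D) ->
     exists y, (forall i, e i < n -> y i = x i) /\ D y.
have [x0] : exists x : I -> C, True by have [c] := carrier_inh C; exists (fun=> c).
have J0 : J 0 x0.
  by move=> D hD /(@filter_ex _ _ FF)[w Dw]; exists (u w).
have /choice[nx hnx] : forall nx : nat * (I -> C), exists x', J nx.1 nx.2 ->
    (forall i, e i < nx.1 -> x' i = nx.2 i) /\ J nx.1.+1 x'.
  move=> [n x]; case: (pselect (J n x)) => [h|nJ]; last by exists x.
  by have [x' hx'] := ulim_step ei sA FF h; exists x'.
pose s := fix s n := if n is m.+1 then nx (m, s m) else x0.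
have Js n : J n (s n).
  by elim: n => [|n IH] //=; exact: (hnx (n, s n) IH).2.
have sS n i : e i < n -> s n.+1 i = s n i.
  by move=> ein; apply: (hnx (n, s n) (Js n)).1.
have sE m n i : e i < n -> n <= m -> s m i = s n i.
  move=> ein; elim: m => [|m IH]; first by case: n ein.
  rewrite leq_eqVlt => /orP[/eqP->//|]; rewrite ltnS => nm.
  by rewrite sS ?IH //; exact: leq_trans nm.
(* Coordinate [i] is frozen from stage [(e i).+1] on, so this diagonal tuple agrees with a late
   enough stage on the finite support of [D]. *)
exists (fun i => s (e i).+1 i) => D hD FD.
have [t [/finite_set_In[l hl] ht]] := fdef_support hD.
pose n := foldr maxn 0 (map (fun i => (e i).+1) l).
have en i : t i -> e i < n.
  move=> /hl; rewrite /n; elim: (l) => //= j l' IH [->|/IH h].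
    exact: leq_maxl.
  by rewrite leq_max h orbT.
have [y [ys Dy]] := Js n _ hD FD; apply: (ht y) => // i ti.
by rewrite ys ?en // (sE n (e i).+1) // en.
Qed.

Lemma aut_sat (s : C -> C) (V : Type) (phi : formula L V) (v : V -> C) :
  automorphism s -> sat phi v <-> sat phi (fun x => s (v x)).
Proof.
move=> [[s' sK s'K] sf sr].
have teE (V' : Type) (t : term L V') (w : V' -> C) :
    teval (fun x => s (w x)) t = s (teval w t).
  by elim: t => //= f ts IH; rewrite sf; congr fint; apply: funext.
elim: phi v => {V} [V v|V t1 t2 v|V R ts v|V p1 IH1 p2 IH2 v|V p IH v] //=.
- by rewrite !teE; split=> [->//|/(can_inj sK)].
- rewrite sr; suff -> : (fun i => s (teval v (ts i))) =
    (fun i => teval (fun x => s (v x)) (ts i)) by [].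
  by apply: funext => i; rewrite teE.
- by rewrite IH1 IH2.
- have E x : (fun o => s (vcons x v o)) = vcons (s x) (fun o => s (v o)).
    by apply: funext => -[].
  split=> h x; last by rewrite IH E.
  by rewrite -(s'K x) -E -IH.
Qed.

Lemma aut_fdef (s : C -> C) (I : Type) A (D : set (I -> C)) (x : I -> C) :
  automorphism s -> (forall c, A c -> s c = c) -> fdef A D ->
  D x <-> D (fun i => s (x i)).
Proof.
move=> hs sA [phi ->]; rewrite /psat (aut_sat _ _ hs).
suff -> : (fun o : I + A => s match o with inl i => x i | inr c => set_val c end) =
  (fun o => match o with inl i => s (x i) | inr c => set_val c end) by [].
by apply: funext => -[i|c] //; apply: sA; exact: set_valP.
Qed.

Lemma aut_td (s : C -> C) (I : Type) (D : set (I -> C)) (x : I -> C) :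
  automorphism s -> type_definable set0 D -> D x -> D (fun i => s (x i)).
Proof.
move=> hs hD; apply: eqtp_td hD => E hE; exact: (proj1 (aut_fdef _ hs _ hE)).
Qed.

(** Coincidences among coordinates and parameters are definable conditions, so sending [x i] to
    [y i] and fixing [A] is a well-defined map. It is elementary by equality of types, and
    homogeneity extends it. *)
Lemma eqtp_aut (I : Type) A (x y : I -> C) : countable [set: I] -> small K A ->
  eqtp A x y -> exists s, [/\ automorphism s, forall c, A c -> s c = c
    & forall i, s (x i) = y i].
Proof.
move=> cI sA xy; pose B := A `|` range x.
have sB : small K B.
  by apply: small_setU => //; exact: countable_range.
have /choice[r hr] : forall b : B, exists o : I + C, param_in A o /\ pval x o = set_val b.
  move=> b; case: (set_valP b) => [Ab|[i _ xi]]; first by exists (inr (set_val b)).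
  by exists (inl i).
pose f (b : B) := pval y (r b).
have fE (b : B) (o : I + C) : param_in A o -> pval x o = set_val b -> f b = pval y o.
  move=> ho xo; have [h1 h2] := hr b.
  by apply: (xy _ (fdef_eq h1 ho)); rewrite /= h2 xo.
have [|s hs sf] := homC (A := B) (f := f) sB.
  move=> n phi v.
  pose D := [set z : 'I_n -> C | sat phi z].
  have hD : fdef (C := C) set0 D.
    exists (frename phi inl); apply/seteqP; split=> z; rewrite /psat sat_rename //.
  have := eqtp_iff xy (fdef_subst hD (@sub0set _ A) (fun k => (hr (v k)).1)).
  rewrite /D /=.
  by rewrite (_ : (fun j => pval x (r (v j))) = (fun i => set_val (v i))) //;
    apply: funext => i; rewrite (hr _).2.
exists s; split=> // [c Ac|i].
  have Bc : B c by left.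
  by rewrite -[c in s c](_ : set_val (exist _ c (mem_set Bc) : B) = c) // sf (fE _ (inr c)).
have Bc : B (x i) by right; exists i.
by rewrite -[x i](_ : set_val (exist _ (x i) (mem_set Bc) : B) = x i) // sf (fE _ (inl i)).
Qed.

End Monster.

(** * Idempotent ultrafilters and limits of tuples along ultrafilters *)

Section Idempotent.
Variables (T : Type) (op : T -> T -> T) (opA : associative op).

Definition filter_conv (F G : set_system T) : set_system T :=
  [set S | F [set x | G [set y | S (op x y)]]].

(** The Ellis-Numakura argument in terms of filters. A filter [F] stands for the closed set of
    ultrafilters above it, which is a subsemigroup once [F] is contained in [filter_conv F F]. A
    maximal such filter is a minimal closed subsemigroup, and any ultrafilter in it is
    idempotent. *)
Lemma idempotent_ultrafilter (F0 : set_system T) : ProperFilter F0 ->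
  F0 `<=` filter_conv F0 F0 ->
  exists U, [/\ UltraFilter U, F0 `<=` U & U `<=` filter_conv U U].
Proof.
move=> PF0 F00.
pose good F := [/\ ProperFilter F, F0 `<=` F & F `<=` filter_conv F F].
have [F [[F_|gF] maxF]] : exists F, (F = set0 \/ good F) /\
    forall G, F `<` G -> ~ (G = set0 \/ good G).
  apply: (@Zorn_bigcup _ [set F | F = set0 \/ good F]) => H Hg totH.
  case: (pselect (exists2 F, H F & good F)) => [[F HF gF]|nH]; last first.
    left; apply/seteqP; split=> // S [F HF FS]; case: (Hg _ HF) => [F0e|gF].
      by rewrite F0e in FS.
    by case: nH; exists F.
  have gH G S : H G -> G S -> good G.
    by move=> HG GS; case: (Hg _ HG) => // G0; rewrite G0 in GS.
  right; split.
  - split; first by move=> [G HG G0]; have [PG _ _] := gH _ _ HG G0; case: PG.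
    split.
    + by exists F => //; have [PF _ _] := gF; exact: filterT.
    + move=> A B [G1 H1 G1A] [G2 H2 G2B]; have [P1 _ _] := gH _ _ H1 G1A.
      have [P2 _ _] := gH _ _ H2 G2B.
      by have [s|s] := totH _ _ H1 H2; [exists G2 => //|exists G1 => //];
        apply: filterI => //; exact: s.
    + move=> A B AB [G HG GA]; exists G => //; have [PG _ _] := gH _ _ HG GA.
      exact: filterS AB GA.
  - by move=> S F0S; exists F => //; have [_ h _] := gF; exact: h.
  - move=> S [G HG GS]; have [PG _ h] := gH _ _ HG GS.
    have {}h : G [set x | G [set y | S (op x y)]] := h _ GS.
    by exists G => //; apply: filterS h => x /= Gx; exists G.
- case: (maxF F0); last by right; split.
  rewrite F_; split=> // /(_ setT); apply; exact: filterT.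
have [PF F0F _] := gF.
have FF S : F S -> F [set x | F [set y | S (op x y)]] by have [_ _] := gF; exact.
have [U [UU FU]] := ultraFilterLemma PF.
have PU := @ultra_proper _ _ UU.
have sub_max G : F `<=` G -> good G -> G `<=` F.
  move=> FG gG; apply: contrapT => nGF; apply: (maxF G); first by split.
  by right.
(* [filter_conv F U] describes the right translate of the subsemigroup by [U], a closed subsemigroup
   inside the first; by minimality the two coincide. *)
have HF : filter_conv F U `<=` F.
  apply: sub_max => [S /FF h|].
    by rewrite /filter_conv /=; apply: filterS h => x /= ; exact: FU.
  split.
  - split; first by rewrite /filter_conv /= => /filter_ex[x /filter_ex[]].
    split.
    + by rewrite /filter_conv /=; apply: filterE => x /=; exact: filterT.
    + rewrite /filter_conv => A B /= hA hB.
      apply: filterS (filterI hA hB) => x [hx hx'].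
      exact: filterI hx hx'.
    + rewrite /filter_conv => A B AB /= hA.
      apply: filterS hA => x; apply: filterS => y; exact: AB.
  - move=> S /F0F/FF h; rewrite /filter_conv /=; by apply: filterS h => x /= ; exact: FU.
  - move=> S /= hS; rewrite /filter_conv /=.
    have := FF _ hS; apply: filterS => x /= /FF h.
    apply: FU; apply: filterS h => y /= h; apply: filterS h => z /= h.
    by apply: filterS h => w /=; rewrite !opA.
pose quo S := [set x | U [set y | S (op x y)]].
(* [G] describes the ultrafilters above [F] whose product with [U] is [U]. It is proper by [HF], so
   maximality of [F] puts [quo S] into [F] for each [S] in [U]. *)
pose G : set_system T := [set R | exists A B, [/\ F A, U B & A `&` quo B `<=` R]].
have FG : F `<=` G.
  by move=> A FA; exists A, setT; split; [exact: FA|exact: filterT|move=> x []].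
have quoG S : U S -> G (quo S).
  by move=> US; exists setT, S; split; [exact: filterT|exact: US|move=> x []].
have GF : G `<=` F.
  apply: sub_max => //.
  have fG : Filter G.
    split; first exact: FG filterT.
      move=> R R' [A [B [FA UB h]]] [A' [B' [FA' UB' h']]].
      exists (A `&` A'), (B `&` B'); split; [exact: filterI|exact: filterI|].
      move=> x [[Ax A'x] q]; split; [apply: h|apply: h']; split=> //;
        apply: filterS q => y [] //.
    by move=> R R' RR' [A [B [FA UB h]]]; exists A, B; split=> // x /h/RR'.
  split.
  - split=> // -[A [B [FA UB h]]].
    suff : U (~` B) by move=> /(filterI UB); rewrite setICr => /filter_ex[].
    apply: FU; apply: HF; apply: filterS FA => x Ax.
    have [q|//] := in_ultra_setVsetC [set y | B (op x y)] UU.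
    by case: (h x (conj Ax q)).
  - by move=> S /F0F/FG.
  - move=> R [A [B [FA UB h]]].
    have hA : G [set x | G [set y | A (op x y)]].
      by apply: (FG); apply: filterS (FF _ FA) => x; exact: FG.
    apply: filterS (filterI hA (quoG _ UB)) => x [/= GA qx].
    apply: filterS (filterI GA (quoG _ qx)) => y [/= Axy qy]; apply: h; split=> //.
    by apply: filterS qy => z /=; rewrite opA.
exists U; split=> //; first by move=> S /F0F/FU.
by move=> S US; apply: FU; apply: GF; exact: quoG.
Qed.

End Idempotent.

Lemma ultra_of_base (W : Type) (P : set (set W)) : P !=set0 ->
  (forall A B : set W, P A -> P B -> exists2 D, P D & D `<=` A `&` B) ->
  (forall A : set W, P A -> A !=set0) -> exists U, UltraFilter U /\ P `<=` U.
Proof.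
move=> [A0 PA0] PI P0; pose F : set_system W := [set S | exists2 A : set W, P A & A `<=` S].
have PF : ProperFilter F.
  split; first by move=> [A PA A0']; have [w /A0'] := P0 _ PA.
  split; first by exists A0.
    move=> S S' [A PA AS] [B PB BS']; have [D PD DAB] := PI _ _ PA PB.
    by exists D => // w /DAB[/AS ? /BS'].
  by move=> S S' SS' [A PA AS]; exists A => // w /AS/SS'.
have [U [UU FU]] := ultraFilterLemma PF; exists U; split=> // A PA.
by apply: FU; exists A.
Qed.

(** * Limits along ultrafilters and compactness *)

Section Ultralimits.
Context {L : signature} {K : Type} {C : structure L}.
Context (nK : ~ countable [set: K]) (satC : saturated K C) (homC : homogeneous K C).
Implicit Types (A B : set C).

Lemma ulim_iff (I W : Type) (U : set_system W) (u : W -> I -> C) A x D :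
  UltraFilter U -> ulim U u A x -> fdef A D -> (D x <-> U (u @^-1` D)).
Proof.
move=> UU hx hD; split; last exact: hx.
move=> Dx; have [//|h] := in_ultra_setVsetC (u @^-1` D) UU.
by case: (hx _ (fdefC hD) h).
Qed.

Lemma ulim_td (I W : Type) (U : set_system W) (u : W -> I -> C) A x D :
  Filter U -> ulim U u A x -> type_definable A D -> U (u @^-1` D) -> D x.
Proof.
move=> FU hx /type_definableP hD UD; apply: hD => E hE DE; apply: hx => //.
by apply: filterS UD => w; exact: DE.
Qed.

Lemma ulimS (I W : Type) (U : set_system W) (u : W -> I -> C) A B x :
  A `<=` B -> ulim U u B x -> ulim U u A x.
Proof. by move=> AB hx D hD; apply: hx; exact: fdefS hD AB. Qed.

Lemma ulim_eqtp (I W : Type) (U : set_system W) (u : W -> I -> C) A x y :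
  UltraFilter U -> ulim U u A x -> (eqtp A x y <-> ulim U u A y).
Proof.
move=> UU hx; split=> [xy D hD /(ulim_iff UU hx hD)|hy D hD].
  exact: xy.
by move=> /(ulim_iff UU hx hD)/(ulim_iff UU hy hD).
Qed.

Lemma ulim_subst (I J W : Type) (U : set_system W) (u : W -> J -> C) A x
    (r : I -> J + C) : (forall i, param_in A (r i)) -> ulim U u A x ->
  ulim U (fun w i => pval (u w) (r i)) A (fun i => pval x (r i)).
Proof.
by move=> hr hx D hD UD; apply: (hx _ (fdef_subst hD (@subset_refl _ A) hr)).
Qed.

Definition join (I J : Type) (x : I -> C) (y : J -> C) (o : I + J) : C :=
  match o with inl i => x i | inr j => y j end.

(* Lifting the limit of [u] to a limit of the pairs [(u, v)]: any limit of the
   pairs has a first coordinate of the same type as [x], and homogeneity moves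
   it to [x]. *)
Lemma ulim_lift (I J W : Type) (U : set_system W) (u : W -> I -> C) (v : W -> J -> C)
    A x : countable [set: I] -> countable [set: J] -> small K A ->
  UltraFilter U -> ulim U u A x ->
  exists y, ulim U (fun w => join (u w) (v w)) A (join x y).
Proof.
move=> cI cJ sA UU hx; have PU := @ultra_proper _ _ UU.
have cIJ := countable_sum cI cJ.
have [z hz] := ulim_exists nK satC (fun w => join (u w) (v w)) cIJ sA PU.
have h1 : ulim U u A (fun i => z (inl i)).
  exact: (@ulim_subst _ _ _ _ _ _ _ (fun i => inl (inl i)) _ hz).
have [s [hs sA' sz]] := eqtp_aut nK homC cI sA (proj2 (ulim_eqtp _ UU h1) hx).
exists (fun j => s (z (inr j))) => D hD UD.
suff -> : join x (fun j => s (z (inr j))) = fun o => s (z o).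
  by apply: (proj1 (aut_fdef _ hs sA' hD)); apply: hz.
by apply: funext => -[i|j] //=; rewrite sz.
Qed.

(* The hypothesis [hP] says that [P] is the projection of a pseudo closed set. *)
Lemma eqtp_compact (I : Type) A B x (P : set (I -> C)) :
  A `<=` B ->
  (forall U, UltraFilter U -> U P -> exists y, P y /\ ulim U id B y) ->
  (forall D, fdef A D -> D x -> exists2 y, D y & P y) ->
  exists y, P y /\ eqtp A x y.
Proof.
move=> AB hP h.
pose Q := [set S | exists D, [/\ fdef A D, D x & S = D `&` P]].
have [|||U [UU QU]] := @ultra_of_base _ Q.
- by exists (setT `&` P), setT; split=> //; exact: fdefT.
- move=> _ _ [D [hD Dx ->]] [D' [hD' D'x ->]].
  exists ((D `&` D') `&` P); first by exists (D `&` D'); split=> //; exact: fdefI.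
  by move=> y [[? ?] ?]; split; split.
- by move=> _ [D [hD Dx ->]]; have [y Dy Py] := h _ hD Dx; exists y; split.
have PU := @ultra_proper _ _ UU.
have [|y [Py hy]] := hP U UU.
  apply: filterS (QU (setT `&` P) _); first by move=> y [].
  by exists setT; split=> //; exact: fdefT.
exists y; split=> // D hD Dx; apply: hy; first exact: fdefS hD AB.
apply: filterS (QU (D `&` P) _); first by move=> z [].
by exists D.
Qed.

Lemma td_compact (I : Type) B (P : set (I -> C)) U : countable [set: I] -> small K B ->
  type_definable B P -> UltraFilter U -> U P -> exists y, P y /\ ulim U id B y.
Proof.
move=> cI sB hP UU UP; have PU := @ultra_proper _ _ UU.
have [y hy] := ulim_exists nK satC id cI sB PU.
by exists y; split=> //; apply: ulim_td hy hP UP.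
Qed.

End Ultralimits.

(** * The group action *)

Section GraphLimits.
Context {L : signature} {K : Type} {C : structure L}.
Context (nK : ~ countable [set: K]) (satC : saturated K C) (homC : homogeneous K C).

(** An operation with type definable graph commutes with limits, since a joint limit of arguments
    and values stays on the graph. [r] and [s] let an argument mix coordinates of the limit with
    fixed parameters. *)
Lemma graph2_ulim (I0 I J J' W : Type) (P : set (I -> C)) (Q : set (J -> C))
    (op : (I -> C) -> (J -> C) -> (J' -> C)) (r : I -> I0 + C) (s : J -> I0 + C)
    (A : set C) (U : set_system W) (u : W -> I0 -> C) (x : I0 -> C) :
  type_definable set0 (graph2 P Q op) ->
  countable [set: I0] -> countable [set: J'] -> small K A -> UltraFilter U ->
  (forall i, param_in A (r i)) -> (forall j, param_in A (s j)) ->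
  U [set w | P (fun i => pval (u w) (r i)) /\ Q (fun j => pval (u w) (s j))] ->
  ulim U u A x ->
  [/\ P (fun i => pval x (r i)), Q (fun j => pval x (s j))
    & ulim U (fun w => op (fun i => pval (u w) (r i)) (fun j => pval (u w) (s j))) A
        (op (fun i => pval x (r i)) (fun j => pval x (s j)))].
Proof.
move=> hg cI cJ sA UU rA sA' hPQ hx; have PU := @ultra_proper _ _ UU.
have [y hy] := ulim_lift nK satC homC (fun w => op (fun i => pval (u w) (r i))
  (fun j => pval (u w) (s j))) cI cJ sA UU hx.
pose lft (o : I0 + C) : (I0 + J') + C :=
  match o with inl i => inl (inl i) | inr c => inr c end.
have lftE (z : I0 -> C) (z' : J' -> C) o : pval (join z z') (lft o) = pval z o by case: o.
have lftA o : param_in A o -> param_in A (lft o) by case: o.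
pose rho (o : I + (J + J')) : (I0 + J') + C := match o with
  | inl i => lft (r i) | inr (inl j) => lft (s j) | inr (inr k) => inl (inr k) end.
have rhoA o : param_in A (rho o) by case: o => [i|[j|k]] //=; exact: lftA.
have hD := type_definable_subst hg (@sub0set _ A) rhoA.
have [|hP hQ hop] := ulim_td _ hy hD.
  apply: filterS hPQ => w [Pw Qw]; rewrite /= /graph2 /=; split.
  - by rewrite (_ : (fun i => _) = (fun i => pval (u w) (r i))) //;
      apply: funext => i; rewrite lftE.
  - by rewrite (_ : (fun i => _) = (fun i => pval (u w) (s i))) //;
      apply: funext => i; rewrite lftE.
  - congr op; apply: funext => i; exact: lftE.
have e1 : (fun i : I => pval (join x y) (rho (inl i))) = (fun i => pval x (r i)).
  by apply: funext => i; exact: lftE.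
have e2 : (fun j : J => pval (join x y) (rho (inr (inl j)))) = (fun j => pval x (s j)).
  by apply: funext => i; exact: lftE.
rewrite /= e1 e2 in hP hQ hop; split=> //; rewrite hop.
exact: (@ulim_subst _ _ _ _ _ _ _ _ _ (fun j => inl (inr j)) _ hy).
Qed.

End GraphLimits.

Section Action.
Context {L : signature} {K : Type} {C : structure L}.
Context (nK : ~ countable [set: K]) (satC : saturated K C) (homC : homogeneous K C).
Context {alpha beta : countable_ordinal} (S : Fsigma_action K C alpha beta).
Implicit Types (A B : set C) (g h : beta -> C) (x y z : alpha -> C).

Local Notation H := (actH S).
Local Notation G := (actG S).
Local Notation V := (actV S).
Local Notation X := (actX S).
Local Notation U := (actU S).
Local Notation E := (orbit_eq S).
Local Notation "g ** h" := (amul S g h) (at level 40, left associativity).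
Local Notation "g @* x" := (aact S g x) (at level 45, right associativity).
Local Notation inv := (ainv S).
Local Notation one := (aone S).

Lemma H_one : H one. Proof. by case: (actH_group S). Qed.
Lemma H_mul g h : H g -> H h -> H (g ** h).
Proof. by case: (actH_group S) => _ + _ _ _; apply. Qed.
Lemma H_inv g : H g -> H (inv g).
Proof. by case: (actH_group S) => _ _ + _ _; apply. Qed.
Lemma HmulA g h k : H g -> H h -> H k -> g ** (h ** k) = g ** h ** k.
Proof. by case: (actH_group S) => _ _ _ + _; apply. Qed.
Lemma Hmul1g g : H g -> one ** g = g.
Proof. by case: (actH_group S) => _ _ _ _ h /h[]. Qed.
Lemma Hmulg1 g : H g -> g ** one = g.
Proof. by case: (actH_group S) => _ _ _ _ h /h[]. Qed.
Lemma HmulVg g : H g -> inv g ** g = one.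
Proof. by case: (actH_group S) => _ _ _ _ h /h[]. Qed.
Lemma HmulgV g : H g -> g ** inv g = one.
Proof. by case: (actH_group S) => _ _ _ _ h /h[]. Qed.
Lemma HmulgK g h : H g -> H h -> g ** h ** inv h = g.
Proof. by move=> Hg Hh; rewrite -HmulA ?HmulgV ?Hmulg1 //; exact: H_inv. Qed.
Lemma HmulKg g h : H g -> H h -> inv g ** (g ** h) = h.
Proof. by move=> Hg Hh; rewrite HmulA ?HmulVg ?Hmul1g //; exact: H_inv. Qed.
Lemma HinvK g : H g -> inv (inv g) = g.
Proof.
by move=> Hg; rewrite -{2}(HmulKg (H_inv Hg) Hg) HmulVg ?Hmulg1 //; do 2 apply: H_inv.
Qed.
Lemma X_act g x : H g -> X x -> X (g @* x).
Proof. by case: (aact_action S) => + _ _; apply. Qed.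
Lemma act1 x : X x -> one @* x = x.
Proof. by case: (aact_action S) => _ + _; apply. Qed.
Lemma actM g h x : H g -> H h -> X x -> g @* h @* x = (g ** h) @* x.
Proof. by case: (aact_action S) => _ _; apply. Qed.
Lemma actK g x : H g -> X x -> inv g @* g @* x = x.
Proof. by move=> Hg Xx; rewrite actM ?HmulVg ?act1 //; exact: H_inv. Qed.
Lemma actKV g x : H g -> X x -> g @* inv g @* x = x.
Proof. by move=> Hg Xx; rewrite actM ?HmulgV ?act1 //; exact: H_inv. Qed.

Lemma G_H g : G g -> H g.
Proof. by case: (actG_subgroup S) => + _ _ _; apply. Qed.
Lemma G_one : G one. Proof. by case: (actG_subgroup S). Qed.
Lemma G_mul g h : G g -> G h -> G (g ** h).
Proof. by case: (actG_subgroup S) => _ _ + _; apply. Qed.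
Lemma G_inv g : G g -> G (inv g).
Proof. by case: (actG_subgroup S) => _ _ _; apply. Qed.
Lemma G_V g : G g -> exists n, V n g.
Proof. by rewrite (actG_V S) => -[n _ h]; exists n. Qed.
Lemma V_G n g : V n g -> G g.
Proof. by move=> h; rewrite (actG_V S); exists n. Qed.
Lemma V_H n g : V n g -> H g. Proof. by move/V_G/G_H. Qed.
Lemma V_inv n g : V n g -> V n (inv g).
Proof. by move=> h; rewrite (actV_sym S n); exists g. Qed.
Lemma V_le n m g : n <= m -> V n g -> V m g.
Proof.
move=> /subnK <-; elim: (m - n) => // k IH /IH h; rewrite addSn.
by rewrite -(Hmulg1 (V_H h)); apply: actV_mul => //; exact: actV_one.
Qed.

Lemma U_le n m x y : n <= m -> U n (x, y) -> U m (x, y).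
Proof. by move=> nm [Xx Xy [g Vg e]]; split=> //; exists g => //; exact: V_le Vg. Qed.
Lemma U_X n x y : U n (x, y) -> X x /\ X y. Proof. by case. Qed.
Lemma U_sym n x y : U n (x, y) -> U n (y, x).
Proof.
move=> [/= Xx Xy [g Vg <-]]; split=> //=; first exact: X_act (V_H Vg) Xx.
by exists (inv g); [exact: V_inv|exact: actK (V_H Vg) Xx].
Qed.
Lemma U_trans n m x y z : U n (x, y) -> U m (y, z) -> U (maxn n m).+1 (x, z).
Proof.
move=> [/= Xx Xy [g Vg <-]] [/= _ Xz [h Vh <-]]; split=> //=.
  by apply: X_act (V_H Vh) _; exact: X_act (V_H Vg) _.
exists (h ** g); first by apply: actV_mul;
  [apply: V_le Vh; exact: leq_maxr|apply: V_le Vg; exact: leq_maxl].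
by rewrite actM //; [exact: V_H Vh|exact: V_H Vg].
Qed.
Lemma U_act n g x : V n g -> X x -> U n (x, g @* x).
Proof. by move=> Vg Xx; split=> //=; [exact: X_act (V_H Vg) Xx|exists g]. Qed.

(** The path goes through [g x], [x], [y], [g y]. What matters is that the new index depends only on
    [r] and [n]. *)
Lemma U_translate r g n x y : V r g -> U n (x, y) ->
  U (maxn (maxn r n).+1 r).+1 (g @* x, g @* y).
Proof.
move=> Vg h; have [Xx Xy] := U_X h.
by apply: U_trans (U_act Vg Xy); apply: U_trans h; apply: U_sym; exact: U_act.
Qed.

Lemma E_U x y : E (x, y) <-> exists n, U n (x, y).
Proof. by split=> [[n _ h]|[n h]]; exists n. Qed.
Lemma E_sym x y : E (x, y) -> E (y, x).
Proof. by move=> /E_U[n h]; apply/E_U; exists n; exact: U_sym. Qed.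
Lemma E_trans x y z : E (x, y) -> E (y, z) -> E (x, z).
Proof. by move=> /E_U[n h] /E_U[m h']; apply/E_U; eexists; exact: U_trans h h'. Qed.
Lemma E_act g x : G g -> X x -> E (x, g @* x).
Proof. by move=> /G_V[n Vg] Xx; apply/E_U; exists n; exact: U_act. Qed.
Lemma E_refl x : X x -> E (x, x).
Proof. by move=> Xx; rewrite -{2}(act1 Xx); exact: E_act G_one Xx. Qed.
Lemma E_G x y : E (x, y) -> exists g, G g /\ y = g @* x.
Proof. by move=> /E_U[n [/= _ _ [g /V_G Gg <-]]]; exists g. Qed.

(** The graph of the action is type definable without parameters, hence preserved by
    automorphisms. *)
Lemma aut_act (s : C -> C) g x : automorphism s -> H g -> X x ->
  (fun i => s ((g @* x) i)) = (fun i => s (g i)) @* (fun i => s (x i)).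
Proof.
move=> hs Hg Xx.
pose t (o : beta + (alpha + alpha)) := match o with
  inl i => g i | inr (inl j) => x j | inr (inr k) => (g @* x) k end.
by have [_ _ <-] : graph2 H X (aact S) (fun o => s (t o)) by apply: aut_td hs (aact_def S) _.
Qed.

Lemma aut_U (s : C -> C) n x y : automorphism s ->
  U n (x, y) -> U n (fun i => s (x i), fun i => s (y i)).
Proof.
move=> hs [/= Xx Xy [g Vg <-]].
have Xs : X (fun i => s (x i)) by apply: aut_td hs (actX_def S) Xx.
have Vs : V n (fun i => s (g i)) by apply: aut_td hs (actV_def S n) Vg.
by rewrite (aut_act hs (V_H Vg) Xx); exact: U_act.
Qed.

Lemma U_eqtp A n x y z : small K A -> range z `<=` A -> eqtp A x y ->
  U n (z, x) -> U n (z, y).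
Proof.
move=> sA zA xy h; have [s [hs sA' sx]] := eqtp_aut nK homC (ord_countable alpha) sA xy.
have := aut_U hs h; rewrite (_ : (fun i => s (z i)) = z).
  by rewrite (_ : (fun i => s (x i)) = y) //; apply: funext.
by apply: funext => i; apply: sA'; apply: zA; exists i.
Qed.

Lemma act_ulim_l (W : Type) (F : set_system W) (u : W -> beta -> C) A g z :
  small K A -> UltraFilter F -> range z `<=` A -> X z -> F [set w | H (u w)] ->
  ulim F u A g -> H g /\ ulim F (fun w => u w @* z) A (g @* z).
Proof.
move=> sA UF zA Xz Fu hg; have PF := @ultra_proper _ _ UF.
have [|||h1 h2 h3] := graph2_ulim nK satC homC (r := inl) (s := fun j => inr (z j))
  (aact_def S) (ord_countable beta) (ord_countable alpha) sA UF _ _ _ hg => //.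
- by move=> j /=; apply: zA; exists j.
- by apply: filterS Fu.
Qed.

Lemma act_ulim_r (W : Type) (F : set_system W) (u : W -> alpha -> C) A g z :
  small K A -> UltraFilter F -> range g `<=` A -> H g -> F [set w | X (u w)] ->
  ulim F u A z -> X z /\ ulim F (fun w => g @* u w) A (g @* z).
Proof.
move=> sA UF gA Hg Fu hz; have PF := @ultra_proper _ _ UF.
have [|||h1 h2 h3] := graph2_ulim nK satC homC (r := fun j => inr (g j)) (s := inl)
  (aact_def S) (ord_countable alpha) (ord_countable alpha) sA UF _ _ _ hz => //.
- by move=> j /=; apply: gA; exists j.
- by apply: filterS Fu.
Qed.

End Action.

(** * Bounded invariant relations and types over a model *)

Lemma In_nth (V : Type) (d x : V) (l : seq V) : List.In x l ->
  exists2 k, k < size l & nth d l k = x.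
Proof.
elim: l => //= y l IH [->|/IH[k kl <-]]; first by exists 0.
by exists k.+1.
Qed.

(** The finitely many variables and parameters of the formula are renamed to positions in a list
    [l], and the variable positions are quantified. Elementarity carries the existential statement
    down to [M] and its matrix back up. *)
Lemma elementary_witness (L : signature) (C : structure L) (M : set C) (I : Type)
    (D : set (I -> C)) : elementary_submodel M -> fdef M D -> D !=set0 ->
  exists2 m, D m & forall i, M (m i).
Proof.
move=> [hM elM] [phi De] [x Dx]; have [[m0 Mm0] _] := hM.
pose c0 : M := exist _ m0 (mem_set Mm0).
have [s [fs hs]] := sat_support phi; have [l hl] := finite_set_In fs.
(* The extra position keeps the index type inhabited and holds the default parameter [c0]. *)
pose rho (k : 'I_(size l).+1) := nth (inr c0) l k.
have /choice[r hr] : forall v, exists k, s v -> rho k = v.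
  move=> v; case: (pselect (s v)) => [/hl/(In_nth (inr c0))[k kl kv]|nsv]; last by exists ord0.
  have kl' : k < (size l).+1 by exact: ltnW.
  by exists (Ordinal kl').
pose psi := frename phi r.
pose J := [seq k <- enum 'I_(size l).+1 | if rho k is inl _ then true else false].
have InJ k : ~ List.In k J -> exists c, rho k = inr c.
  move=> nJ; case e : (rho k) => [i|c]; last by exists c.
  case: nJ; rewrite /J; have : k \in enum 'I_(size l).+1 by rewrite mem_enum.
  elim: (enum _) => //= k' t IH; rewrite inE => /orP[/eqP <-|/IH h].
    by rewrite e; left.
  by case: (rho k') => //; right.
have InJ' c k : rho k = inr c -> ~ List.In k J.
  move=> kc; rewrite /J; elim: (enum _) => //= k' t IH.
  case e : (rho k') => [i|c'] //= -[kk|//].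
  by rewrite kk kc in e.
pose w0 (k : 'I_(size l).+1) : substructure hM := match rho k with
  | inr c => exist _ (set_val c) (set_valP c) | inl _ => exist _ m0 Mm0 end.
have : sat (foldr (@Ex L _) psi J) (fun k => sval (w0 k) : C).
  apply/sat_Exs; pose v (o : I + M) : C := match o with inl i => x i | inr c => set_val c end.
  exists (fun k => v (rho k)); split.
    by move=> k /InJ[c kc]; rewrite /w0 kc.
  rewrite sat_rename (hs _ _ v); last by move=> o so; rewrite hr.
  by move: Dx; rewrite De.
move=> /(elM _ _ w0)/sat_Exs[w [ww0 /elM]]; rewrite sat_rename => hw.
exists (fun i => sval (w (r (inl i))) : C); last by move=> i; exact: svalP.
rewrite De /psat; rewrite (hs _ _ (fun o => sval (w (r o)) : C)) // => -[i|c] // so.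
by rewrite ww0 /w0 ?hr //; exact: InJ' (hr _ so).
Qed.

Section Bounded.
Context {L : signature} {K : Type} {C : structure L}.
Context (nK : ~ countable [set: K]) (satC : saturated K C) (homC : homogeneous K C).

(** Coheirs are invariant over [M]: for a tuple [m] of [M] the condition [D (join x m)] on [x] is
    definable over [M], so it passes to [y], and [U] concentrates on such [m]. *)
Lemma coheir_eqtp (I J : Type) (M : set C) (U : set_system (J -> C)) (x y : I -> C)
    (z w : J -> C) :
  UltraFilter U -> U [set m | forall j, M (m j)] -> eqtp M x y ->
  ulim U id (M `|` range x) z -> ulim U id (M `|` range y) w ->
  eqtp M (join x z) (join y w).
Proof.
move=> UU UM xy hz hw D hD; have PU := @ultra_proper _ _ UU.
have key (x' : I -> C) : fdef (M `|` range x') [set m | D (join x' m)].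
  have := fdef_subst (r := fun o : I + J => match o with
    | inl i => inr (x' i) | inr j => inl j end) hD (@subsetUl _ M (range x')).
  rewrite (_ : [set m | D (join x' m)] = [set m : J -> C | D (fun o => pval m
    (match o with | inl i => inr (x' i) | inr j => inl j end))]).
    by apply; case=> [i|j] //=; right; exists i.
  apply/seteqP; split=> m /=; suff -> : join x' m = fun o => pval m
    (match o with | inl i => inr (x' i) | inr j => inl j end) by [];
    by apply: funext; case.
move=> /(ulim_iff UU hz (key x)) Ux; apply: (hw _ (key y)).
apply: filterS (filterI Ux UM) => m [/= Dxm Mm].
have hm : fdef M [set x' : I -> C | D (join x' m)].
  have := fdef_subst (r := fun o : I + J => match o with
    | inl i => inl i | inr j => inr (m j) end) hD (@subset_refl _ M).
  rewrite (_ : [set x' | D (join x' m)] = [set x' : I -> C | D (fun o => pval x'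
    (match o with | inl i => inl i | inr j => inr (m j) end))]).
    by apply; case=> [i|j] /=.
  apply/seteqP; split=> x' /=; suff -> : join x' m = fun o => pval x'
    (match o with | inl i => inl i | inr j => inr (m j) end) by [];
    by apply: funext; case.
exact: (xy _ hm).
Qed.

Context {alpha beta : countable_ordinal} (S : Fsigma_action K C alpha beta).

(** One representative per class contributes countably many coordinates. With uncountably many
    classes, [card_setX_nat] keeps the total below the bound on the number of classes. *)
Lemma small_representatives : bounded_action S -> exists R : set C, small K R /\
  forall x, actX S x -> exists y, [/\ actX S y, range y `<=` R & orbit_eq S (y, x)].
Proof.
move=> bdd; pose cls (x : alpha -> C) := [set y | orbit_eq S (x, y)].
pose Q := [set cls x | x in actX S].
have /choice[rep hrep] : forall c, exists x, Q c -> actX S x /\ cls x = c.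
  move=> c; case: (pselect (Q c)) => [[x Xx xc]|nQ]; first by exists x.
  by have [c0] := carrier_inh C; exists (fun=> c0).
pose R := \bigcup_(c in Q) range (rep c).
exists R; split; last first.
  move=> x Xx; have Qx : Q (cls x) by exists x.
  have [Xr rx] := hrep _ Qx; exists (rep (cls x)); split=> //.
    by move=> _ [i _ <-]; exists (cls x) => //; exists i.
  have : cls x x by exact: E_refl.
  by rewrite -[in X in X -> _]rx.
case: (pselect (countable Q)) => cQ.
  apply: small_countable => //; apply: bigcup_countable => // c _.
  exact: countable_range (ord_countable alpha).
have /countable_injP[e ei] := ord_countable alpha; have [c0] := carrier_inh C.
have /choice[d hd] : forall n, exists o : option alpha, forall i, e i = n -> o = Some i.
  move=> n; case: (pselect (exists i, e i = n)) => [[i ein]|ne].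
    by exists (Some i) => j ejn; congr Some; apply: ei; rewrite ?inE // ein.
  by exists None => i ein; case: ne; exists i.
pose f (cn : set (alpha -> C) * nat) := if d cn.2 is Some i then rep cn.1 i else c0.
apply: (@small_le _ _ _ Q) => //.
apply: card_le_trans (@card_setX_nat _ Q _); last by move=> /finite_set_countable.
apply: card_le_trans (card_image_le f _); apply: subset_card_le.
by move=> _ [c Qc [i _ <-]]; exists (c, e i) => //; rewrite /f /= (hd _ i).
Qed.

(** Let [U] be a coheir of the type of [x] over [M], and realize it by [c] and then [c'] over the
    representatives [R]. They have the same type over [R], so both are equivalent to one
    representative. A realization [d] over [M], [x] and [y] forms with [x], and with [y], a pair of
    the type of [(c, c')], so both are equivalent to [d]. *)
Lemma eqtp_orbit_eq (M : set C) x y : bounded_action S -> elementary_submodel M ->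
  countable M -> actX S x -> eqtp M x y -> orbit_eq S (x, y).
Proof.
move=> bdd elM cM Xx xy.
have Xtd B : type_definable B (actX S) by apply: type_definableS (actX_def S) _.
have Xy : actX S y by exact: eqtp_td xy (Xtd M) Xx.
have [R [sR hR]] := small_representatives bdd.
pose P := [set T | exists D, [/\ fdef M D, D x & T = D `&` [set m | forall i, M (m i)]]].
have [|||U [UU PU]] := @ultra_of_base _ P.
- by exists (setT `&` [set m | forall i, M (m i)]), setT; split=> //; exact: fdefT.
- move=> _ _ [D [hD Dx ->]] [D' [hD' D'x ->]].
  exists ((D `&` D') `&` [set m | forall i, M (m i)]).
    by exists (D `&` D'); split=> //; exact: fdefI.
  by move=> z [[? ?] ?]; split; split.
- move=> _ [D [hD Dx ->]]; have [|m Dm Mm] := elementary_witness elM hD.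
    by exists x.
  by exists m; split.
have PrU := @ultra_proper _ _ UU.
have UM : U [set m | forall i, M (m i)].
  apply: filterS (PU (setT `&` [set m | forall i, M (m i)]) _); first by move=> z [].
  by exists setT; split=> //; exact: fdefT.
have xlim B z : M `<=` B -> ulim U id B z -> eqtp M x z.
  move=> MB hz D hD Dx; apply: hz; first exact: fdefS hD MB.
  apply: filterS (PU (D `&` [set m | forall i, M (m i)]) _); first by move=> ? [].
  by exists D.
have ca := ord_countable alpha.
have crange (z : alpha -> C) : countable (range z).
  exact: countable_range.
have sB B : small K B -> exists z, ulim U id B z.
  by move=> hB; exact: (ulim_exists nK satC id ca hB PrU).
have sRM : small K (R `|` M) by exact: small_setU.
have [c hc] := sB _ sRM.
have Xc : actX S c by apply: eqtp_td (xlim _ _ (@subsetUr _ R M) hc) (Xtd M) Xx.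
have sRMc : small K (R `|` M `|` range c) by exact: small_setU.
have [c' hc'] := sB _ sRMc.
have [r [Xr rR /E_U[n rc]]] := hR _ Xc.
have cc' : eqtp (R `|` M) c c'.
  apply: (proj2 (ulim_eqtp _ UU hc)); apply: ulimS hc'; exact: subsetUl.
have rc' : actU S n (r, c').
  by apply: (U_eqtp nK homC sRM _ cc' rc) => z /rR; left.
have Ecc' : orbit_eq S (c, c').
  by apply: E_trans (_ : orbit_eq S (r, c')); [apply: E_sym|]; apply/E_U; exists n.
have sM : small K M by exact: small_countable.
have [d hd] := sB _ (small_setU nK (small_setU nK sM (crange x)) (crange y)).
have Ed z : eqtp M c z -> ulim U id (M `|` range z) d -> orbit_eq S (z, d).
  move=> cz hdz; have hc2 : ulim U id (M `|` range c) c'.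
    apply: ulimS hc' => t [?|?]; [by left; right|by right].
  have h := coheir_eqtp UU UM cz hc2 hdz.
  have cJ := countable_sum ca ca.
  have [s [hs _ se]] := eqtp_aut nK homC cJ sM h.
  have /E_U[k] := Ecc' => /(aut_U hs) hk; apply/E_U; exists k; move: hk.
  rewrite (_ : (fun i => s (c i)) = z).
    rewrite (_ : (fun i => s (c' i)) = d) //.
    by apply: funext => i; exact: (se (inr i)).
  by apply: funext => i; exact: (se (inl i)).
have cx : eqtp M c x by apply: eqtp_sym; exact: xlim (@subsetUr _ R M) hc.
apply: E_trans (Ed _ cx _) (E_sym (Ed _ (eqtp_trans cx xy) _)).
  by apply: ulimS hd; exact: subsetUl.
by apply: ulimS hd => t [?|?]; [by left; left|by right].
Qed.

End Bounded.

(** * A recurrent point *)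

Section Recurrence.
Context {L : signature} {K : Type} {C : structure L}.
Context (nK : ~ countable [set: K]) (satC : saturated K C) (homC : homogeneous K C).
Context {alpha beta : countable_ordinal} (S : Fsigma_action K C alpha beta).

Local Notation H := (actH S).
Local Notation G := (actG S).
Local Notation V := (actV S).
Local Notation X := (actX S).
Local Notation U := (actU S).
Local Notation E := (orbit_eq S).
Local Notation "g ** h" := (amul S g h) (at level 40, left associativity).
Local Notation "g @* x" := (aact S g x) (at level 45, right associativity).
Local Notation inv := (ainv S).
Local Notation one := (aone S).

Lemma unbounded_orbit a : X a -> ~ strongly_closed_on S (Gorbit S a) ->
  forall n, exists g, G g /\ ~ U n (a, g @* a).
Proof.
move=> Xa nsc n; apply: contrapT => hn; apply: nsc; exists n.+1.
have {}hn g : G g -> U n (a, g @* a).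
  by move=> Gg; apply: contrapT => h; apply: hn; exists g.
apply/seteqP; split=> -[x y] [h1 h2]; split=> //; last by apply/E_U; exists n.+1.
move: h2 => [/= [g Gg <-] [h Gh <-]].
by have := U_trans (U_sym (hn _ Gg)) (hn _ Gh); rewrite maxnn.
Qed.

Lemma HinvM g h : H g -> H h -> inv (g ** h) = inv h ** inv g.
Proof.
move=> Hg Hh; have Hgh := H_mul Hg Hh; have Hi := H_inv Hgh.
have e : inv (g ** h) ** g ** h = one by rewrite -HmulA // HmulVg.
have {}e : inv (g ** h) ** g = inv h.
  rewrite -(HmulgK (H_mul Hi Hg) Hh) e Hmul1g //; exact: H_inv.
by rewrite -e HmulgK.
Qed.

Definition gen (e : nat -> beta -> C) (l : nat * bool) := if l.2 then inv (e l.1) else e l.1.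
(** Formal words replace group elements because [amul] is associative on [H] only, whereas
    concatenation is associative everywhere, as idempotent ultrafilters require. *)
Definition word (e : nat -> beta -> C) (s : seq (nat * bool)) :=
  foldr (fun l => amul S (gen e l)) one s.

Lemma word_G e s : (forall n, G (e n)) -> G (word e s).
Proof.
move=> he; elim: s => [|[n b] s IH] /=; first exact: G_one.
by apply: G_mul => //; rewrite /gen /=; case: b => //; exact: G_inv.
Qed.

Lemma word_cat e s t : (forall n, G (e n)) -> word e (s ++ t) = word e s ** word e t.
Proof.
move=> he; have hw u : H (word e u) by apply: G_H; exact: word_G.
have hl l : H (gen e l) by apply: G_H; rewrite /gen; case: l.2 => //; exact: G_inv.
by elim: s => [|l s IH] /=; [rewrite Hmul1g|rewrite IH HmulA].
Qed.

Lemma word_inv e s : (forall n, G (e n)) -> exists t, word e t = inv (word e s).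
Proof.
move=> he; have hw u : H (word e u) by apply: G_H; exact: word_G.
have hl l : H (gen e l) by apply: G_H; rewrite /gen; case: l.2 => //; exact: G_inv.
elim: s => [|[n b] s [t IH]] /=.
  exists [::] => /=; rewrite -[LHS](HmulVg (H_one S)) Hmulg1 //; exact: H_inv (H_one S).
exists (t ++ [:: (n, ~~ b)]); rewrite word_cat // HinvM // IH; congr (_ ** _).
rewrite /= Hmulg1 // /gen /=; case: (b) => //=; rewrite HinvK //; exact: G_H.
Qed.

(* [x] is the limit of [g a] along an idempotent ultrafilter of unbounded group
   elements [g]: idempotence gives the recurrence in the last clause, and
   shiftiness puts [x] in the orbit of [a]. *)
Lemma recurrent_point M a : bounded_action S -> elementary_submodel M -> countable M ->
  shifty S a -> ~ strongly_closed_on S (Gorbit S a) ->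
  exists (Gam : set (beta -> C)) A x,
  [/\ [/\ Gam `<=` G, Gam one, forall g h, Gam g -> Gam h -> Gam (g ** h)
         & forall g, Gam g -> Gam (inv g)],
      [/\ countable A, M `<=` A, range a `<=` A & forall g, Gam g -> range g `<=` A],
      E (a, x)
    & forall D, fdef A D -> D x -> forall n,
        exists g, [/\ Gam g, D (g @* x) & ~ U n (x, g @* x)]].
Proof.
move=> bdd elM cM [Xa sh] nsc.
have /choice[e /all_and2[Ge far]] := unbounded_orbit Xa nsc.
pose ev := word e.
have evG s : G (ev s) by exact: word_G.
have evH s : H (ev s) by exact: G_H.
have evD s t : ev (s ++ t) = ev s ** ev t by exact: word_cat.
pose F0 : set_system (seq (nat * bool)) :=
  [set R | exists m, forall s, ~ U m (a, ev s @* a) -> R s].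
have PF0 : ProperFilter F0.
  split.
    move=> [m hm]; apply: (hm [:: (m, false)]); rewrite /ev /= Hmulg1; first exact: far.
    exact: G_H (Ge m).
  split; first by exists 0.
    move=> A B [m hm] [k hk]; exists (maxn m k) => s hs; split.
      by apply: hm => h; apply: hs; apply: U_le h; exact: leq_maxl.
    by apply: hk => h; apply: hs; apply: U_le h; exact: leq_maxr.
  by move=> A B AB [m hm]; exists m => s /hm/AB.
(* A fixed prefix [u] changes the distance from [a] by a bounded amount: if [uv] moves [a] within
   [U m], then translating back by the inverse of [u] bounds how far [v] moves [a]. *)
have F00 : F0 `<=` filter_conv cat F0 F0.
  move=> R [m hm]; exists 0 => u _; have [r Vr] := G_V (evG u).
  exists (maxn r (maxn (maxn r m).+1 r).+1).+1 => v hv; apply: hm => h; apply: hv.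
  move: h; rewrite evD -actM // => /(U_translate (V_inv Vr)).
  rewrite actK //; last by apply: X_act.
  by move=> h; apply: U_trans h; exact: U_act (V_inv Vr) Xa.
have [F [UF F0F FF]] := idempotent_ultrafilter (@catA _) PF0 F00.
have PF := @ultra_proper _ _ UF.
pose A := M `|` range a `|` \bigcup_s range (ev s).
have cA : countable A.
  apply: countable_setU.
    by apply: countable_setU => //; exact: countable_range (ord_countable alpha).
  apply: bigcup_countable => [|s _]; first exact: countableP.
  exact: countable_range (ord_countable beta).
have sA : small K A by exact: small_countable.
have aA : range a `<=` A by move=> t ?; left; right.
have evA s : range (ev s) `<=` A by move=> t ?; right; exists s.
have MA : M `<=` A by move=> t ?; left; left.
have FH : F [set s | H (ev s)] by exact: filterE.
have [h hh] := ulim_exists nK satC ev (ord_countable beta) sA PF.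
have [Hh hx] := act_ulim_l nK satC homC sA UF aA Xa FH hh.
pose x := h @* a; have Xx : X x by exact: X_act.
pose B := A `|` range x.
have sB : small K B.
  by apply: small_setU => //; exact: countable_range (ord_countable alpha).
have [h' hh'] := ulim_exists nK satC ev (ord_countable beta) sB PF.
have [Hh' hx'] := act_ulim_l nK satC homC sB UF (@subsetUr _ A _) Xx FH hh'.
(* By idempotence, [D] holds at [uv a] for most [u] and then most [v]; letting [v] tend to the limit
   gives [D] at [u x] for most [u]. *)
have rec D : fdef A D -> D x -> F [set s | D (ev s @* x)].
  move=> hD /(ulim_iff UF hx hD)/FF; rewrite /filter_conv /=.
  apply: filterS => u /= hu.
  have [|_ hux] := act_ulim_r nK satC homC sA UF (evA u) (evH u) _ hx.
    by apply: filterE => v /=; exact: X_act.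
  apply: hux => //; apply: filterS hu => v /=.
  by rewrite evD actM.
have xh'x : eqtp A x (h' @* x).
  move=> D hD Dx; apply: hx'; last exact: rec.
  exact: fdefS hD (@subsetUl _ _ _).
have xh'a : eqtp A x (h' @* a).
  apply: (proj2 (ulim_eqtp _ UF hx)).
  exact: (act_ulim_l nK satC homC sA UF aA Xa FH (ulimS (@subsetUl _ _ _) hh')).2.
have Ex1 := eqtp_orbit_eq nK satC homC bdd elM cM Xx (eqtpS MA xh'x).
have Ex2 := eqtp_orbit_eq nK satC homC bdd elM cM Xx (eqtpS MA xh'a).
(* Right shifty: the pair [h'h a], [h a] brings [h' a] close to [a], and [h' a] is equivalent to
   [x]. Left shifty: the pair [h' a], [h'h a] brings [h a] itself close to [a]. *)
have Eax : E (a, x).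
  case: sh => sh.
    have /E_U[k hk] := E_sym Ex1; have [n hn] := sh k.
    have := hn _ _ (H_mul Hh' Hh) Hh; rewrite -actM // HmulgK // => /(_ hk) hn'.
    by apply: E_sym; apply: E_trans Ex2 _; apply/E_U; exists n.
  have /E_U[k hk] := E_trans (E_sym Ex2) Ex1; have [n hn] := sh k.
  have [+ _] := hn _ _ Hh' (H_mul Hh' Hh); rewrite -actM // HmulKg // => /(_ hk) hn'.
  by apply: E_sym; apply/E_U; exists n.
(* Shiftiness shows that an element moving [x = v a] little moves [a] little, while [F] contains the
   words moving [a] far. The left case applies both implications to the inverse of [u]. *)
have xfar m : F [set s | ~ U m (x, ev s @* x)].
  have [v [Gv xv]] := E_G Eax; have [r Vr] := G_V Gv; have Hv := G_H Gv.
  suff [n hn] : exists n, forall u, H u -> U m (x, u @* x) -> U n (a, u @* a).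
    apply: F0F; exists n => s hs hs'; apply: hs; exact: hn.
  case: sh => sh.
    have [n hn] := sh m; exists n => u Hu hu; apply: U_sym.
    have := hn _ _ (H_mul Hu Hv) Hv; rewrite HmulgK // -actM // -xv; apply.
    exact: U_sym.
  have [n1 hn1] := sh (maxn m r).+1; have [n2 hn2] := sh (maxn n1 r).+1.
  exists n2 => u Hu hu; have Hui := H_inv Hu.
  have xa : U r (x, a) by apply: U_sym; rewrite xv; exact: U_act.
  have [_ h1] := hn1 _ _ Hui Hv; rewrite HinvK // -actM // -xv in h1.
  have [h2 _] := hn2 _ _ Hui (H_one S); rewrite HinvK // Hmulg1 // act1 // in h2.
  apply: U_sym; apply: h2; apply: (U_trans _ xa); apply: h1.
  exact: U_trans (U_sym hu) xa.
exists (range ev), A, x; split=> //.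
- split.
  + by move=> _ [s _ <-].
  + by exists [::].
  + by move=> _ _ [s _ <-] [t _ <-]; exists (s ++ t) => //; exact: word_cat.
  + by move=> _ [s _ <-]; have [t ht] := word_inv s Ge; exists t.
- by split=> // _ [s _ <-].
- move=> D hD Dx n; have [s [Ds ns]] := filter_ex (filterI (rec _ hD Dx) (xfar n)).
  by exists (ev s); split=> //; exists s.
Qed.

End Recurrence.

(** * Baire category *)

Section Category.
(* The space is [Z], whose open sets are the traces of the members of [op]. *)
Variables (P : Type) (Z : set P) (op : set (set P)).

Definition hits (W : set P) := W `&` Z !=set0.

Definition nwd (N : set P) := forall W, op W -> hits W ->
  exists W', [/\ op W', hits W', W' `<=` W & forall z, W' z -> Z z -> ~ N z].

Definition meager (S : set P) := exists N : nat -> set P,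
  (forall n, nwd (N n)) /\ forall z, Z z -> S z -> exists n, N n z.

Definition baire_property (S : set P) :=
  exists2 O, op O & meager [set z | ~ (S z <-> O z)].

Lemma nwd0 : nwd set0.
Proof. by move=> W oW mW; exists W; split=> // z _ _ []. Qed.

Lemma meagerS (S S' : set P) : (forall z, Z z -> S z -> S' z) -> meager S' -> meager S.
Proof. by move=> SS' [N [hN h]]; exists N; split=> // z Zz /(SS' _ Zz); exact: h. Qed.

Lemma nwd_meager (N : set P) : nwd N -> meager N.
Proof. by move=> hN; exists (fun=> N); split=> // z _ Nz; exists 0. Qed.

Lemma meager_bigcup (S : nat -> set P) : (forall n, meager (S n)) -> meager (\bigcup_n S n).
Proof.
move=> /choice[N hN]; exists (fun n => if unpickle n is Some km then N km.1 km.2 else set0).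
split=> [n|z Zz [k _ Sz]].
  case: (unpickle n) => [[k m]|] /=; first exact: (hN k).1.
  exact: nwd0.
by have [m Nz] := (hN k).2 z Zz Sz; exists (pickle (k, m)); rewrite pickleK.
Qed.

Lemma meagerU (S S' : set P) : meager S -> meager S' -> meager (S `|` S').
Proof.
move=> mS mS'; apply: meagerS (_ : meager (\bigcup_n (if n is 0 then S else S'))).
  by move=> z _ [?|?]; [exists 0|exists 1].
by apply: meager_bigcup => -[].
Qed.

Context (opT : op setT) (opI : forall A B, op A -> op B -> op (A `&` B)).
Context (opU : forall F : set (set P), F `<=` op -> op (\bigcup_(B in F) B)).

Lemma baire_property_open O : op O -> baire_property O.
Proof. by move=> oO; exists O => //; exists (fun=> set0); split=> [n|z _ []//]; exact: nwd0. Qed.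

Lemma baire_propertyS (S S' : set P) : (forall z, Z z -> (S z <-> S' z)) ->
  baire_property S -> baire_property S'.
Proof.
move=> SS' [O oO h]; exists O => //; apply: meagerS h => z Zz /= nh hS.
by apply: nh; rewrite -SS'.
Qed.

(** [O'] is the exterior of [O]. The points outside both form the boundary of an open set, which is
    nowhere dense. *)
Lemma baire_propertyC (S : set P) : baire_property S -> baire_property (~` S).
Proof.
move=> [O oO mO]; pose O' := \bigcup_(W in [set W | op W /\ ~ hits (W `&` O)]) W.
exists O'; first by apply: opU => W [].
have nO : nwd [set z | ~ O z /\ ~ O' z].
  move=> W oW mW; case: (pselect (hits (W `&` O))) => mWO.
    by exists (W `&` O); split=> //; [exact: opI|move=> z [_ Oz] _ []].
  by exists W; split=> // z Wz _ [_]; apply; exists W.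
apply: meagerS (meagerU mO (nwd_meager nO)) => z Zz /= h.
case: (pselect (O z)) => Oz.
  left => SO; apply: h; split=> [nS|[W [oW nW] Wz] _]; first by case: nS; apply/SO.
  by apply: nW; exists z.
case: (pselect (O' z)) => O'z; last by right.
by left => SO; apply: h; split=> // _ /SO.
Qed.

Lemma baire_property_bigcup (S : nat -> set P) :
  (forall n, baire_property (S n)) -> baire_property (\bigcup_n S n).
Proof.
move=> hS; have /choice[O hO] : forall n, exists O, op O /\ meager [set z | ~ (S n z <-> O z)].
  by move=> n; have [O oO h] := hS n; exists O.
exists (\bigcup_n O n).
  rewrite (_ : \bigcup_n O n = \bigcup_(B in range O) B).
    by apply: opU => _ [n _ <-]; exact: (hO n).1.
  by rewrite bigcup_image.
apply: meagerS (meager_bigcup (fun n => (hO n).2)) => z Zz /= nh.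
apply: contrapT => hn; apply: nh.
have e n : S n z <-> O n z by apply: contrapT => h; apply: hn; exists n.
by split=> -[n _ h]; exists n => //; apply/e.
Qed.

Context (baire : forall N : nat -> set P, (forall n, nwd (N n)) ->
  forall W, op W -> hits W -> exists z, [/\ W z, Z z & forall n, ~ N n z]).

Lemma not_meager W : op W -> hits W -> ~ meager W.
Proof.
move=> oW mW [N [hN h]]; have [z [Wz Zz nN]] := baire hN oW mW.
by have [n /nN] := h z Zz Wz.
Qed.

Lemma comeager_point S : Z !=set0 -> meager S -> exists2 z, Z z & ~ S z.
Proof.
move=> [z0 Zz0] [N [hN h]]; have [|z [_ Zz nN]] := baire hN opT; first by exists z0.
by exists z => // Sz; have [n /nN] := h z Zz Sz.
Qed.

(** Otherwise [S] and its complement agree, up to meager sets, with open sets that both meet [Z].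
    Transitivity yields an open set meeting [Z] and mapped into both; by invariance each of its
    points in [Z] falls into a preimage of a meager error, so it is meager, against Baire. *)
Lemma zero_one_law (Phi : set (P -> P)) (S : set P) :
  (forall f, Phi f -> forall z, Z z -> Z (f z)) ->
  (forall f, Phi f -> forall N, nwd N -> nwd (f @^-1` N)) ->
  (forall W W', op W -> op W' -> hits W -> hits W' -> exists f f' W0,
     [/\ Phi f, Phi f', op W0, hits W0 & W0 `<=` (f @^-1` W) `&` (f' @^-1` W')]) ->
  (forall f, Phi f -> forall z, Z z -> (S z <-> S (f z))) ->
  baire_property S -> meager S \/ meager (~` S).
Proof.
move=> ZPhi nwdPhi trans inv bS; have [O' oO' mO'] := baire_propertyC bS.
have [O oO mO] := bS.
case: (pselect (hits O)) => hO; last first.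
  left; apply: meagerS mO => z Zz Sz /= SO; apply: hO; exists z; split=> //; exact/SO.
case: (pselect (hits O')) => hO'; last first.
  right; apply: meagerS mO' => z Zz Sz /= SO; apply: hO'; exists z; split=> //; exact/SO.
have [f [f' [W [Pf Pf' oW mW hW]]]] := trans _ _ oO oO' hO hO'.
have mpre h R : Phi h -> meager R -> meager (h @^-1` R).
  move=> Ph [N [hN hR]]; exists (fun n => h @^-1` N n); split.
    by move=> n; exact: nwdPhi.
  by move=> z Zz Rz; exact: hR (ZPhi _ Ph _ Zz) Rz.
case: (not_meager oW mW); apply: meagerS (meagerU (mpre _ _ Pf mO) (mpre _ _ Pf' mO')).
move=> z Zz /hW[/= Ofz O'fz]; case: (pselect (S z)) => Sz; [right|left] => h.
  by move/h: O'fz; apply; apply/(inv _ Pf' _ Zz).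
by apply: Sz; apply/(inv _ Pf _ Zz)/h.
Qed.

End Category.

(** * Non-smoothness *)

Lemma ctype_open (L : signature) (C : structure L) (I : Type) (A : set C)
    (O : set (ctype I A)) : open O -> forall p, O p ->
  exists2 phi, ctype_set p phi & forall q : ctype I A, ctype_set q phi -> O q.
Proof.
move=> [D _ <-] p [phi Dphi pphi]; exists phi => // q qphi; by exists phi.
Qed.

Lemma cantor_bit_open (i : nat) : open [set y : cantor_space | y i = true].
Proof.
pose T := fun _ : nat => bool : topologicalType.
have h : continuous (fun y : cantor_space => y i : bool) by exact: (@proj_continuous nat T i).
have := @open_comp _ _ _ [set true] (fun x _ => h x).
by apply; apply: discrete_open.
Qed.

Lemma subtype_open (T : topologicalType) (A : set T) (B : set A) : open B ->
  exists2 O : set T, open O & B = set_val @^-1` O.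
Proof. by move=> [O oO <-]; exists O. Qed.

Section Nonsmooth.
Context {L : signature} {K : Type} {C : structure L}.
Context (nK : ~ countable [set: K]) (satC : saturated K C) (homC : homogeneous K C).
Context {alpha beta : countable_ordinal} (S : Fsigma_action K C alpha beta).

Local Notation H := (actH S).
Local Notation G := (actG S).
Local Notation V := (actV S).
Local Notation X := (actX S).
Local Notation U := (actU S).
Local Notation E := (orbit_eq S).
Local Notation "g ** h" := (amul S g h) (at level 40, left associativity).
Local Notation "g @* x" := (aact S g x) (at level 45, right associativity).
Local Notation inv := (ainv S).
Local Notation one := (aone S).

(** The topology on [X] pulled back from types over [A]. Only points of [X] are constrained, since
    the action is meaningful only there. *)
Definition aopen (A : set C) : set (set (alpha -> C)) :=
  [set W | forall x, X x -> W x ->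
     exists D, [/\ fdef A D, D x & forall y, X y -> D y -> W y]].

Lemma fdef_aopen A D : fdef A D -> aopen A D.
Proof. by move=> hD x _ Dx; exists D. Qed.

Lemma aopenI A W W' : aopen A W -> aopen A W' -> aopen A (W `&` W').
Proof.
move=> oW oW' x Xx [Wx W'x]; have [D [hD Dx DW]] := oW x Xx Wx.
have [D' [hD' D'x DW']] := oW' x Xx W'x; exists (D `&` D').
by split=> //; [exact: fdefI|move=> y Xy [Dy D'y]; split; [exact: DW|exact: DW']].
Qed.

Lemma aopen_bigcup A F : F `<=` aopen A -> aopen A (\bigcup_(W in F) W).
Proof.
move=> oF x Xx [W FW Wx]; have [D [hD Dx DW]] := oF _ FW x Xx Wx.
by exists D; split=> // y Xy Dy; exists W => //; exact: DW.
Qed.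

(** Continuity of translation by [g]. If it failed at [x], compactness would give [y] of the type of
    [x] over [A] with [g y] outside [D0], against an automorphism fixing [A], hence [g], and taking
    [x] to [y]. *)
Lemma aopen_act A g W : small K A -> H g -> range g `<=` A -> aopen A W ->
  aopen A [set x | W (g @* x)].
Proof.
move=> sA Hg gA oW x Xx /= Wgx; have [D0 [hD0 D0x D0W]] := oW _ (X_act Hg Xx) Wgx.
apply: contrapT => nD.
have {}nD D : fdef A D -> D x -> exists2 y, D y & X y /\ ~ D0 (g @* y).
  move=> hD Dx; apply: contrapT => hn; apply: nD; exists D; split=> // y Xy Dy.
  apply: D0W; first exact: X_act.
  by apply: contrapT => nD0; apply: hn; exists y.
have hP F : UltraFilter F -> F [set y | X y /\ ~ D0 (g @* y)] ->
    exists y, (X y /\ ~ D0 (g @* y)) /\ ulim F id A y.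
  move=> UF FP; have PF := @ultra_proper _ _ UF.
  have [y hy] := ulim_exists nK satC id (ord_countable alpha) sA PF.
  have [|Xy hgy] := act_ulim_r nK satC homC sA UF gA Hg _ hy.
    by apply: filterS FP => z [].
  exists y; split=> //; split=> //; apply: (hgy _ (fdefC hD0)).
  by apply: filterS FP => z [].
have [y [[Xy nDy] xy]] := eqtp_compact (@subset_refl _ A) hP nD.
apply: nDy; have [s [hs sA' sx]] := eqtp_aut nK homC (ord_countable alpha) sA xy.
have : D0 (fun i => s ((g @* x) i)) by apply: (proj1 (aut_fdef _ hs sA' hD0)).
rewrite (aut_act hs Hg Xx) (_ : (fun i => s (g i)) = g).
  by rewrite (_ : (fun i => s (x i)) = y) //; apply: funext.
by apply: funext => i; apply: sA'; apply: gA; exists i.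
Qed.

(** The condition is a projection along [V n], so a limit of the witnesses [gam] is taken in [V n].
    Since [b] may lie outside [A], its coordinates are added as parameters. *)
Lemma U_compact A n b c : small K A -> X b ->
  (forall D, fdef A D -> D c -> exists2 y, D y & U n (b, y)) ->
  exists y, U n (b, y) /\ eqtp A c y.
Proof.
move=> sA Xb h; pose B := A `|` range b.
have sB : small K B.
  by apply: small_setU => //; exact: countable_range (ord_countable alpha).
apply: (@eqtp_compact _ _ _ A B c (fun y => U n (b, y)) (@subsetUl _ _ _)) => // F UF FU.
have PF := @ultra_proper _ _ UF.
have /choice[gam hgam] : forall y, exists g, U n (b, y) -> V n g /\ g @* b = y.
  move=> y; case: (pselect (U n (b, y))) => [[/= _ _ [g Vg gb]]|nU]; last by exists one.
  by exists g.
have [g hg] := ulim_exists nK satC gam (ord_countable beta) sB PF.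
have Vg : V n g.
  apply: (ulim_td _ hg (type_definableS (actV_def S n) (@sub0set _ B))).
  by apply: filterS FU => y /hgam[].
have [|_ hgb] := act_ulim_l nK satC homC sB UF (@subsetUr _ A _) Xb _ hg.
  by apply: filterS FU => y /hgam[/V_H].
exists (g @* b); split; first exact: U_act.
move=> D hD FD; apply: hgb => //.
by apply: filterS (filterI FD FU) => y [/= Dy /hgam[_ ->]].
Qed.

Context (bdd : bounded_action S) (M : set C).
Context (elM : elementary_submodel M) (cM : countable M).

(** This replaces arbitrary small parameters by those of [M]. Equality of types over [M] refines
    [E], so [Y] is a union of classes of that equality and avoids the saturation of each complement
    of [F n]; that saturation is closed over [M] by compactness. *)
Lemma pseudo_Gdelta_aopen (Y : set (alpha -> C)) : pseudo_Gdelta K Y ->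
  Y `<=` X -> (forall x y, Y x -> E (x, y) -> Y y) ->
  exists O : nat -> set (alpha -> C), (forall n, aopen M (O n)) /\
    forall x, Y x <-> forall n, O n x.
Proof.
move=> [F oF YF] YX Yinv.
exists (fun n => [set x | ~ exists y, ~ F n y /\ eqtp M x y]); split=> [n x Xx|x].
  move=> nx; have [B sB hB] := oF n; apply: contrapT => nD; apply: nx.
  apply: (@eqtp_compact _ _ _ M (B `|` M) x (~` F n) (@subsetUr _ _ _)).
    move=> W UW WF; apply: (td_compact nK satC (ord_countable alpha) _ _ UW WF).
      exact: small_setU.
    exact: type_definableS hB (@subsetUl _ _ _).
  move=> D hD Dx; apply: contrapT => hn; apply: nD; exists D; split=> // y Xy Dy.
  move=> [z [nFz yz]]; apply: hn; exists z => //; exact: (yz _ hD).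
split=> [Yx n [y [nFy xy]]|h].
  have Exy := eqtp_orbit_eq nK satC homC bdd elM cM (YX _ Yx) xy.
  by apply: nFy; have := Yinv _ _ Yx Exy; rewrite YF; apply.
by rewrite YF => n _; apply: contrapT => nFx; apply: (h n); exists x; split=> // D.
Qed.

(** * Category on the orbit closure *)

Section Orbit.
Variables (A : set C) (Gam : set (beta -> C)) (x : alpha -> C) (Y : set (alpha -> C)).
Hypotheses (cA : countable A) (MA : M `<=` A) (GamG : Gam `<=` G).
Hypotheses (Gam1 : Gam one) (GamM : forall g h, Gam g -> Gam h -> Gam (g ** h)).
Hypotheses (GamV : forall g, Gam g -> Gam (inv g)).
Hypotheses (GamA : forall g, Gam g -> range g `<=` A).
Hypotheses (GY : pseudo_Gdelta K Y) (YX : Y `<=` X).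
Hypotheses (Yinv : forall x y, Y x -> E (x, y) -> Y y) (Yx : Y x).

Definition orbit_closure : set (alpha -> C) :=
  [set y | Y y /\ forall D, fdef A D -> D y -> exists2 g, Gam g & D (g @* x)].
Local Notation Z := orbit_closure.

Let sA : small K A. Proof. exact: small_countable. Qed.
Let GamH g : Gam g -> H g. Proof. by move=> /GamG/G_H. Qed.
Let ZX y : Z y -> X y. Proof. by case=> /YX. Qed.

Lemma orbit_closure_act g y : Gam g -> Z y -> Z (g @* y).
Proof.
move=> gG [Yy hy]; have Xy := YX Yy; split.
  by apply: Yinv Yy _; exact: E_act (GamG gG) Xy.
move=> D hD Dgy.
have [D' [hD' D'y D'D]] := aopen_act sA (GamH gG) (GamA gG) (fdef_aopen hD) Xy Dgy.
have [h hG D'h] := hy _ hD' D'y; exists (g ** h); first exact: GamM.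
have Xx := YX Yx; rewrite -actM //; [|exact: GamH|exact: GamH].
by apply: D'D => //; apply: X_act => //; exact: GamH.
Qed.

Lemma orbit_closure_base : Z x.
Proof. by split=> // D hD Dx; exists one => //; rewrite act1 //; exact: YX. Qed.

Lemma orbit_dense W : aopen A W -> hits Z W -> exists2 g, Gam g & W (g @* x).
Proof.
move=> oW [y [Wy Zy]]; have [D [hD Dy DW]] := oW _ (ZX Zy) Wy.
have [g gG Dg] := Zy.2 _ hD Dy; exists g => //; apply: DW => //.
by apply: X_act; [exact: GamH|exact: YX].
Qed.

(** Definable sets meeting [Z] are shrunk, entering [O n] and avoiding [N n] at step [n]. Saturation
    gives a limit of an ultrafilter containing all their traces on [Z]; the sets [O n] put it in
    [Y], and being a limit of points of [Z] keeps it in the closure. *)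
Lemma orbit_closure_baire (N : nat -> set (alpha -> C)) :
  (forall n, nwd Z (aopen A) (N n)) -> forall W, aopen A W -> hits Z W ->
  exists z, [/\ W z, Z z & forall n, ~ N n z].
Proof.
move=> hN W oW [y0 [Wy0 Zy0]].
have [O [oO YO]] := pseudo_Gdelta_aopen GY YX Yinv.
have [D0 [hD0 D0y D0W]] := oW _ (ZX Zy0) Wy0.
pose good D := fdef A D /\ exists2 y, D y & Z y.
have /choice[nx hnx] : forall nD : nat * set (alpha -> C), exists D', good nD.2 ->
    [/\ good D', D' `<=` nD.2, forall z, X z -> D' z -> O nD.1 z
      & forall z, Z z -> D' z -> ~ N nD.1 z].
  move=> [n D]; case: (pselect (good D)) => [[hD [y Dy Zy]]|ng]; last by exists D.
  have [|W' [oW' [z [W'z Zz]] W'D W'N]] := hN n D (fdef_aopen hD).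
    by exists y.
  have [D1 [hD1 D1z D1W]] := oW' _ (ZX Zz) W'z.
  have [D2 [hD2 D2z D2O]] := oO n z (ZX Zz) (proj1 (YO z) Zz.1 n).
  exists (D `&` (D1 `&` D2)) => _; split.
  - split; first by apply: fdefI => //; apply: fdefI => //; exact: fdefS hD2 MA.
    by exists z => //; split=> //; exact: W'D.
  - by move=> t [].
  - by move=> t Xt [_ [_ D2t]]; exact: D2O.
  - by move=> t Zt [_ [D1t _]]; apply: W'N => //; apply: D1W => //; exact: ZX.
pose D := fix D n := if n is m.+1 then nx (m, D m) else D0.
have gD n : good (D n).
  by elim: n => [|n IH]; [split=> //; exists y0|have [] := hnx (n, D n) IH].
have DS n m : n <= m -> D m `<=` D n.
  move=> /subnK <-; elim: (m - n) => // k IH; rewrite addSn.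
  by apply: subset_trans IH; have [] := hnx (k + n, D (k + n)) (gD _).
have [|||F [UF FD]] := @ultra_of_base _ [set T | exists n, T = D n `&` Z].
- by exists (D 0 `&` Z), 0.
- move=> _ _ [n ->] [m ->]; exists (D (maxn n m) `&` Z); first by eexists.
  by move=> t [Dt Zt]; split; split=> //; apply: DS Dt; [exact: leq_maxl|exact: leq_maxr].
- by move=> _ [n ->]; have [_ [y Dy Zy]] := gD n; exists y.
have PF := @ultra_proper _ _ UF.
have [z hz] := ulim_exists nK satC id (ord_countable alpha) sA PF.
have Dz n : D n z.
  apply: hz; first by have [] := gD n.
  by apply: filterS (FD (D n `&` Z) _); [move=> t []|exists n].
have FZ : F Z by apply: filterS (FD (D 0 `&` Z) _); [move=> t []|exists 0].
have Xz : X z.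
  apply: (ulim_td _ hz (type_definableS (actX_def S) (@sub0set _ A))).
  by apply: filterS FZ => t /ZX.
have Zz : Z z.
  split.
    apply/YO => n; have [_ _ h _] := hnx (n, D n) (gD n).
    by apply: h => //; exact: (Dz n.+1).
  move=> B hB Bz; apply: contrapT => nB; apply: (hz _ (fdefC hB)) => //.
  apply: filterS FZ => t [_ ht] /= Bt; have [g gG Bg] := ht _ hB Bt.
  by apply: nB; exists g.
exists z; split=> //; first by apply: D0W => //; exact: (Dz 0).
by move=> n; have [_ _ _ h] := hnx (n, D n) (gD n); apply: h => //; exact: (Dz n.+1).
Qed.

Lemma nwd_act g N : Gam g -> nwd Z (aopen A) N -> nwd Z (aopen A) [set y | N (g @* y)].
Proof.
move=> gG hN W oW [y [Wy Zy]]; have Hg := GamH gG; have gV := GamV gG.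
have oW2 := aopen_act sA (GamH gV) (GamA gV) oW.
have [|W' [oW' [z [W'z Zz]] W'W W'N]] := hN _ oW2.
  exists (g @* y); split; last exact: orbit_closure_act.
  by rewrite /= actK //; exact: ZX.
exists (W `&` [set t | W' (g @* t)]); split.
- by apply: aopenI => //; apply: aopen_act => //; exact: GamA.
- exists (inv g @* z); split; last exact: orbit_closure_act.
  by split; [exact: W'W|rewrite /= actKV //; exact: ZX].
- by move=> t [].
- by move=> t [_ W't] Zt; apply: W'N => //; exact: orbit_closure_act.
Qed.

(** Both sets meet the orbit of [x], so [x] itself lies in the common preimage. *)
Lemma orbit_transitive W W' : aopen A W -> aopen A W' -> hits Z W -> hits Z W' ->
  exists f f' W0, [/\ [set aact S g | g in Gam] f, [set aact S g | g in Gam] f',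
    aopen A W0, hits Z W0 & W0 `<=` (f @^-1` W) `&` (f' @^-1` W')].
Proof.
move=> oW oW' mW mW'; have [g gG Wg] := orbit_dense oW mW.
have [g' gG' Wg'] := orbit_dense oW' mW'.
exists (aact S g), (aact S g'), ([set y | W (g @* y)] `&` [set y | W' (g' @* y)]).
split=> //; [by exists g|by exists g'| |].
- by apply: aopenI; apply: aopen_act => //; (exact: GamH || exact: GamA).
- by exists x; split=> //; exact: orbit_closure_base.
Qed.

(* The sets [U n (b, -)] cover the class of [b], so by Baire one of them is
   dense in a nonempty open set; compactness then reaches the orbit of [x]. *)
Lemma comeager_class b : X b -> meager Z (aopen A) [set y | ~ E (b, y)] ->
  exists n W g, [/\ aopen A W, Gam g, W (g @* x)
    & forall h, Gam h -> W (h @* x) ->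
        exists y, U n (b, y) /\ eqtp A (h @* x) y].
Proof.
move=> Xb mE.
have [n] : exists n, ~ nwd Z (aopen A) [set y | U n (b, y)].
  apply: contrapT => hn.
  have mE' : meager Z (aopen A) [set y | E (b, y)].
    exists (fun n => [set y | U n (b, y)]); split=> [n|z _ /E_U//].
    by apply: contrapT => h; apply: hn; exists n.
  have oT : aopen A setT by exact: fdef_aopen (fdefT _ A).
  have mT : hits Z setT by exists x; split=> //; exact: orbit_closure_base.
  apply: (not_meager orbit_closure_baire oT mT).
  apply: meagerS (meagerU mE mE') => z _ _; case: (pselect (E (b, z))); by [right|left].
rewrite /nwd => /existsNP[W /not_implyP[oW /not_implyP[mW nW]]].
have [g gG Wg] := orbit_dense oW mW.
exists n, W, g; split=> // h hG Wh; apply: U_compact => // D hD Dh.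
apply: contrapT => hn; apply: nW; exists (W `&` D); split.
- by apply: aopenI => //; exact: fdef_aopen.
- exists (h @* x); split=> //; exact: orbit_closure_act orbit_closure_base.
- by move=> t [].
- by move=> z [Wz Dz] _ Uz; apply: hn; exists z.
Qed.

(** Each bit of [f] is invariant under [Gam] with the Baire property, so by the zero-one law it is
    constant off a meager set. Hence [f] is constant on a comeager set, which lies in a single
    class. *)
Lemma smooth_comeager_class (f : types_of M Y -> cantor_space) : borel_function f ->
  (forall p q : types_of M Y, rel_on_types E (set_val p) (set_val q) <-> f p = f q) ->
  exists b, Y b /\ meager Z (aopen A) [set y | ~ E (b, y)].
Proof.
move=> bf fE.
have oT : aopen A setT by exact: fdef_aopen (fdefT _ A).
pose tr (B : set (types_of M Y)) := [set y | exists p, set_val p = tp M y /\ B p].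
have ptE y : Y y -> exists p : types_of M Y, set_val p = tp M y.
  by move=> Yy; exists (exist _ (tp M y) (mem_set (ex_intro2 _ _ y Yy erefl))).
have valI (p q : types_of M Y) : set_val p = set_val q -> p = q by exact: val_inj.
(* The sets whose pullback [tr] has the Baire property form a sigma-algebra, and it contains the
   open sets because [M] is contained in [A]. *)
have bp B : <<s open >> B -> baire_property Z (aopen A) (tr B).
  move: B; apply: (@smallest_sub _ (sigma_algebra setT) open
    [set B | baire_property Z (aopen A) (tr B)]); last first.
    move=> B /subtype_open[O oO ->] /=.
    apply: (@baire_propertyS _ _ _ [set y | O (tp M y)]).
      move=> y [/ptE[p py] _]; split=> [Oy|[q [qy Oq]]]; last by rewrite /= -qy.
      by exists p; split=> //; rewrite /= py.
    apply: baire_property_open => y Xy Oy; have [phi phiy hphi] := ctype_open oO Oy.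
    exists (psat phi); split=> // [|z _ phiz]; last exact: hphi.
    by apply: fdefS MA; exists phi.
  split.
  - apply: (@baire_propertyS _ _ _ set0); first by move=> y _; split=> // -[p []].
    by apply: baire_property_open => z _ [].
  - move=> B /= hB; apply: (@baire_propertyS _ _ _ (~` tr B)).
      move=> y [/ptE[p py] _]; split=> [nB|[q [qy [_ nB]]] [p' [py' Bp']]].
        by exists p; split=> //; split=> // Bp; apply: nB; exists p.
      by apply: nB; rewrite (valI q p') // qy.
    by apply: baire_propertyC hB; [exact: aopenI|exact: aopen_bigcup].
  - move=> B hB; apply: (@baire_propertyS _ _ _ (\bigcup_n tr (B n))).
      move=> y _; split=> [[n _ [p [py Bp]]]|[p [py [n _ Bp]]]].
        by exists p; split=> //; exists n.
      by exists n => //; exists p.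
    by have := baire_property_bigcup (@aopen_bigcup A) hB.
pose bit i := [set y | exists p : types_of M Y, set_val p = tp M y /\ f p i = true].
have inv i g : Gam g -> forall y, Z y -> (bit i y <-> bit i (g @* y)).
  move=> gG y Zy; have [_ Zgy] := (Zy, orbit_closure_act gG Zy).
  have [p py] := ptE _ Zy.1; have [q qgy] := ptE _ Zgy.1.
  have fpq : f p = f q.
    apply/fE; exists y, (g @* y); rewrite py qgy; split; try exact/eqtp_tp.
    exact: E_act (GamG gG) (ZX Zy).
  split=> -[p' [py' fp']].
    by exists q; split=> //; rewrite -fpq (valI p p') // py.
  by exists p; split=> //; rewrite fpq (valI q p') // qgy.
have /choice[c hc] : forall i, exists c : bool,
    meager Z (aopen A) [set y | ~ (bit i y <-> c = true)].
  move=> i; have [|||||m|m] := @zero_one_law _ Z (aopen A) (@aopenI A)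
      (@aopen_bigcup A) orbit_closure_baire [set aact S g | g in Gam] (bit i).
  - by move=> _ [g gG <-] y; exact: orbit_closure_act.
  - by move=> _ [g gG <-] N; exact: nwd_act.
  - exact: orbit_transitive.
  - by move=> _ [g gG <-]; exact: inv.
  - apply: (bp (f @^-1` [set y | y i = true])); apply: bf.
    by apply: sub_sigma_algebra; exact: cantor_bit_open.
  - exists false; apply: meagerS m => y _ /= h; apply: contrapT => nb; apply: h; by split.
  - exists true; apply: meagerS m => y _ /= h nb; apply: h; by split.
(* [b] avoids all the exceptional sets, so the value of [f] at its type is the generic sequence
   [c]. *)
have [|b Zb nb] := comeager_point oT orbit_closure_baire _ (meager_bigcup hc).
  by exists x; exact: orbit_closure_base.
exists b; split; first exact: Zb.1.
apply: meagerS (meager_bigcup hc) => y Zy /= nE.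
apply: contrapT => ny; apply: nE.
have [p pb] := ptE _ Zb.1; have [q qy] := ptE _ Zy.1.
have bits z (r : types_of M Y) i : set_val r = tp M z ->
    ~ (\bigcup_n [set y | ~ (bit n y <-> c n = true)]) z -> f r i = c i.
  move=> rz nz; have {nz} [h1 h2] : bit i z <-> c i = true.
    by apply: contrapT => h; apply: nz; exists i.
  case e : (c i) in h1 h2 *.
    by have [r' [rz' fr']] := h2 erefl; rewrite (valI r r') // rz.
  by case fr : (f r i) => //; have := h1 (ex_intro _ r (conj rz fr)).
have /fE[b' [y' [rb ry Eby]]] : f p = f q.
  by apply: funext => i; rewrite (bits b p i) // (bits y q i).
rewrite pb in rb; rewrite qy in ry.
move: rb ry => /eqtp_tp rb /eqtp_tp ry.
apply: E_trans (eqtp_orbit_eq nK satC homC bdd elM cM (ZX Zb) rb) _.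
exact: E_trans Eby (E_sym (eqtp_orbit_eq nK satC homC bdd elM cM (ZX Zy) ry)).
Qed.

End Orbit.

End Nonsmooth.

Theorem theorem3p33
    (L : signature) (countL : countable_signature L)
    (T : theory L) (complT : complete_theory T)
    (K : Type) (C : structure L) (monsterC : monster K T C)
    (alpha beta : countable_ordinal)
    (S : Fsigma_action K C alpha beta) (bddS : bounded_action S)
    (Y : set (alpha -> C)) (YGdelta : pseudo_Gdelta K Y)
    (YX : subset Y (actX S))
    (Yinv : forall x y, Y x -> orbit_eq S (x, y) -> Y y) :
  (exists a, [/\ Y a, shifty S a & ~ strongly_closed_on S (Gorbit S a)]) ->
  ~ smooth (orbit_eq S) Y.
Proof.
move=> [a [Ya sh nsc]] [M [elM cM [f bf fE]]].
have [nK _ satC homC] := monsterC.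
have [Gam [A [x [[GamG Gam1 GamM GamV] [cA MA aA GamA] Eax rec]]]] :=
  recurrent_point nK satC homC bddS elM cM sh nsc.
have Yx := Yinv _ _ Ya Eax; have Xa := YX _ Ya; have Xx := YX _ Yx.
have sA : small K A by exact: small_countable.
have GamH g : Gam g -> actH S g by move=> /GamG; exact: G_H.
have [b [Yb mb]] := smooth_comeager_class nK satC homC bddS elM cM cA MA GamG Gam1
  GamM GamV GamA YGdelta YX Yinv Yx bf fE.
have class c Xc mc := comeager_class (b := c) nK satC homC bddS elM cM cA MA GamG
  Gam1 GamM GamA YGdelta YX Yinv Yx Xc mc.
have Eax' g : Gam g -> orbit_eq S (a, aact S g x).
  by move=> gG; apply: E_trans Eax _; exact: E_act (GamG _ gG) Xx.
(* The class of [b] reaches, up to type over [A], a point of the orbit of [x], and that orbit lies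
   in the class of [a]. *)
have Eab : orbit_eq S (a, b).
  have [n [W [g [_ gG Wg h]]]] := class b (YX _ Yb) mb.
  have [y [bUy gy]] := h _ gG Wg.
  have Egy : orbit_eq S (aact S g x, y).
    apply: (eqtp_orbit_eq nK satC homC bddS elM cM) (eqtpS MA gy).
    by apply: X_act => //; exact: GamH.
  apply: E_trans (Eax' _ gG) _; apply: E_trans Egy _; apply: E_sym.
  by apply/E_U; exists n.
(* The comeager class is therefore that of [a], whose coordinates lie in [A]. *)
have [|n [W [g [oW gG Wg h]]]] := class a Xa.
  apply: meagerS mb => y _ nEay Eby; apply: nEay; exact: E_trans Eab Eby.
have gV := GamV _ gG; have [r Vr] := G_V (GamG _ gV).
have /E_U[k Uxa] := E_sym Eax.
have [D [hD Dx DW]] := aopen_act nK satC homC sA (GamH _ gG) (GamA _ gG) oW Xx Wg.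
(* The index is that of the path from [x] to [a] by [U k], to its translate by the inverse of [g] by
   [U r], and on to [g' x] by [U_translate]. *)
have [g' [gG' Dg' far]] := rec D hD Dx (maxn k (maxn r (maxn (maxn r n).+1 r).+1).+1).+1.
have Xg'x : actX S (aact S g' x) by apply: X_act => //; exact: GamH.
have Wgg' := DW _ Xg'x Dg'.
rewrite /= actM // in Wgg'; try exact: GamH.
have [y [Uay gy]] := h _ (GamM _ _ gG gG') Wgg'.
(* As [a] lies in [A], being of the type over [A] of a point in [U n (a, -)] already means lying in
   that set. *)
have Uag : actU S n (a, aact S g (aact S g' x)).
  rewrite actM //; try exact: GamH.
  exact: (U_eqtp nK homC sA aA (eqtp_sym gy) Uay).
apply: far; apply: U_trans Uxa _; apply: U_trans (U_act Vr Xa) _.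
have := U_translate Vr Uag; rewrite actK //; exact: GamH.
Qed.
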